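(* Let $(y_1,x_1),\ldots,(y_n,x_n)$ be independent and identically distributed with $x\sim N(0,I_p)$ ($I_p$ the $p\times p$ identity) and $y\mid x=x_0\sim N(\beta^Tx_0,\sigma^2)$, where $\beta\in\mathbb{R}^p$ and $\sigma^2>0$ are unknown. Let $X$ be the $n\times p$ matrix with rows $x_i^T$, $Y=(y_1,\ldots,y_n)^T$, $\mu=X\beta$, and define \[ \hat\sigma^2_{Dicker}=\frac{p+n+1}{n(n+1)}\|Y\|^2-\frac{1}{n(n+1)}\|X^TY\|^2 . \] Assume $p=p_n$ with $p/n\to c$ as $n\to\infty$ for some $c\in[1,\infty)$, and that $\sigma^2$ and $\|\beta\|^2$ are bounded as $n\to\infty$. Then there exist a sequence of sets $A_n$ (of $n\times p$ matrices) and a constant $C$ such that $\mathrm{pr}(X\in A_n)\to1$ as $n\to\infty$, and for $X\in A_n$ and any $\xi>0$, \[ \mathrm{pr}_X\left(|\hat\sigma^2_{Dicker}-\sigma^2|\ge\xi\right)\le C\,\frac{g(c,n,\mu,\sigma^2)}{\xi^2\sqrt n}, \] where \[ g(c,n,\mu,\sigma^2)=1+2(c+1)\left\{\left(\tfrac1n\|\mu\|^2\right)^2+\sigma^4\right\}+\frac{4\sigma^2}{n}\|\mu\|^2+2\sigma^4 . \]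
   Context: $\mathrm{pr}_X$ denotes probability conditional on the design matrix $X$ (i.e., for fixed $X$, only $Y$ is random, with $y_i\sim N(\mu_i,\sigma^2)$ independently, $\mu_i=x_i^T\beta$), while $\mathrm{pr}(X\in A_n)$ is the unconditional probability under $x_i\sim N(0,I_p)$ i.i.d. $\|\cdot\|$ is the Euclidean norm. *)

(* Defs.v *)
From HB Require Import structures.
From mathcomp Require Import all_boot all_order all_algebra.
From mathcomp Require Import all_classical all_reals all_analysis.
Set Implicit Arguments. Unset Strict Implicit. Unset Printing Implicit Defensive.
Import Order.TTheory GRing.Theory Num.Theory.
Import numFieldNormedType.Exports.
Local Open Scope classical_set_scope.
Local Open Scope ring_scope.

Section Defs.
Context {R : realType}.

(* Law of a vector (y_1,...,y_k) with y_i ~ N(m_i, s^2) independent,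
   evaluated at a set A of sequences of length k:
   the product of the normal measures, as an iterated Lebesgue integral. *)
Fixpoint gaussN (m : seq R) (s : R) (A : set (seq R)) : \bar R :=
  match m with
  | [::] => ((\1_A [::] : R)%:E)
  | m0 :: m' =>
      (\int[normal_prob m0 s]_t gaussN m' s [set u | A (t :: u)])%E
  end.

Definition seq_col (k : nat) (u : seq R) : 'cV[R]_k := \col_i nth 0 u i.
Definition col_seq (k : nat) (v : 'cV[R]_k) : seq R := [seq v i 0 | i <- enum 'I_k].

(* pr_X : for fixed design, Y has independent entries y_i ~ N(mu_i, sigma2) *)
Definition prY (n : nat) (mu : 'cV[R]_n) (sigma2 : R) (E : set 'cV[R]_n) : \bar R :=
  gaussN (col_seq mu) (Num.sqrt sigma2) [set u | E (seq_col n u)].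

(* pr : law of the n x p design with i.i.d. N(0,1) entries (rows x_i ~ N(0,I_p)) *)
Definition prX (n p : nat) (A : set 'M[R]_(n, p)) : \bar R :=
  gaussN (nseq (n * p) 0) 1 [set u | A (vec_mx (trmx (seq_col (n * p) u)))].

Definition sqnorm (k : nat) (v : 'cV[R]_k) : R := \sum_i (v i 0) ^+ 2.

Definition sigma2_dicker (n p : nat) (X : 'M[R]_(n, p)) (Y : 'cV[R]_n) : R :=
  (p + n + 1)%:R / (n * (n + 1))%:R * sqnorm Y
  - (n * (n + 1))%:R^-1 * sqnorm (X^T *m Y).

Definition gfun (c : R) (n : nat) (mu : 'cV[R]_n) (sigma2 : R) : R :=
  1 + 2 * (c + 1) * ((n%:R^-1 * sqnorm mu) ^+ 2 + sigma2 ^+ 2)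
  + 4 * sigma2 / n%:R * sqnorm mu + 2 * sigma2 ^+ 2.

End Defs.

(* Main.v *)
(* Chebyshev's inequality reduces the claim to a bound C / sqrt n on the
   conditional mean squared error of the estimator, a quadratic form Y^T M Y with
   M = a I - b X X^T.  That error is controlled by six polynomial statistics of X
   (the deviations of |x_i|^2 from p, the powers of v_i = x_i^T beta, the
   degenerate U-statistic of v_i x_i - beta, and the Gram matrix), each of which
   exceeds n^(1/4) times its typical size with probability O(n^(-1/4)) by Markov's
   inequality; A_n is the set of designs with small conditional error.

   All polynomials involved have degree at most 4 in each Gaussian variable, so
   their expectations are computed exactly by the three-point Gauss-Hermite rule:
   every moment computation takes place on a finite product space. *)
Require Import Defs.
From HB Require Import structures.
From mathcomp Require Import all_boot all_order all_algebra.
From mathcomp Require Import all_classical all_reals all_analysis.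
From mathcomp Require Import measurable_realfun.
From mathcomp Require Import ring lra.
Set Implicit Arguments. Unset Strict Implicit. Unset Printing Implicit Defensive.
Import Order.TTheory GRing.Theory Num.Theory.
Import numFieldNormedType.Exports.
Local Open Scope classical_set_scope.
Local Open Scope ring_scope.

(** [gaussN] accepts arbitrary sets, so nothing that needs measurability, such as the complement
    rule, is used on it. Monotonicity survives: an indicator is placed above or below a polynomial,
    whose iterated integral is known exactly. Exactness limits the degree in each single variable,
    not the total degree. This shapes the statistics: the squared bias has degree 8 in one entry of
    [X], so Markov's inequality is applied to six quantities of admissible degree instead of the
    risk, and the product [stat_mix] is first split by Cauchy-Schwarz.

    The scale [L] = n^(1/4) comes from the budget. With all statistics at their typical sizes the
    risk bound is of order 1/n = [L ^- 4], while the target is 1/sqrt n = [L ^- 2]. The spare factor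
    [L ^+ 2] pays for products of two statistics, each inflated by one factor [L]. *)

(** * Integrals against a normal law *)

Section NormalIntegral.
Context {R : realType}.
Notation mu := (@lebesgue_measure R).
Implicit Types (m s : R).

(* No measurability is needed: an integral is a difference of two suprema over simple functions. *)
Lemma le_integralT d (T : measurableType d) (P : {measure set T -> \bar R})
    (f g : T -> \bar R) :
  (forall x, (f x <= g x)%E) -> (\int[P]_x f x <= \int[P]_x g x)%E.
Proof.
move=> fg; rewrite /integral !patch_setT; apply: leeB; apply: le_ereal_sup.
  move=> _ [h /= hf <-]; exists h => //= x; apply: le_trans (hf x) _.
  by rewrite !funeposE ge_max !le_max fg lexx orbT.
move=> _ [h /= hf <-]; exists h => //= x; apply: le_trans (hf x) _.
by rewrite !funenegE ge_max !le_max leeN2 fg lexx orbT.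
Qed.

(** The Radon-Nikodym derivative of the law and its density have the same integral over every
    measurable set, hence agree almost everywhere. *)
Lemma ge0_integral_normal_prob m s (f : R -> R) : measurable_fun setT f ->
  (forall x, 0 <= f x) ->
  (\int[normal_prob m s]_x (f x)%:E =
   \int[mu]_x (f x * normal_pdf m s x)%:E)%E.
Proof.
move=> mf f0.
have dom := @normal_prob_dominates R m s.
have f0E x : (0 <= (f x)%:E)%E by rewrite lee_fin.
have mfE : measurable_fun setT (EFin \o f) by exact/measurable_EFinP.
rewrite -(Radon_Nikodym_SigmaFinite.change_of_variables dom f0E measurableT mfE).
under [RHS]eq_integral do rewrite EFinM.
have mpdf : measurable_fun setT (fun x => (normal_pdf m s x)%:E).
  by apply/measurable_EFinP; exact: measurable_normal_pdf.
have iRN := Radon_Nikodym_SigmaFinite.f_integrable dom.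
apply: ae_eq_integral => //.
- apply: emeasurable_funM; first exact/measurable_EFinP.
  exact: (measurable_int mu iRN).
- by apply: emeasurable_funM => //; exact/measurable_EFinP.
- apply: ae_eqe_mul2l; apply: integral_ae_eq => //.
  by move=> E _ mE; rewrite -Radon_Nikodym_SigmaFinite.f_integral.
Qed.

(** Integrability is not assumed: the density is nonnegative, so it passes through positive and
    negative parts, and both sides are the same difference of extended integrals. *)
Lemma integral_normal_prob m s (f : R -> R) : measurable_fun setT f ->
  (\int[normal_prob m s]_x (f x)%:E =
   \int[mu]_x (f x * normal_pdf m s x)%:E)%E.
Proof.
move=> mf; rewrite integralE [RHS]integralE.
have pdf0 x := normal_pdf_ge0 m s x.
have posE x : (fun x => (f x)%:E)^\+%E x = (Num.max (f x) 0)%:E.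
  by rewrite funeposE EFin_max.
have negE x : (fun x => (f x)%:E)^\-%E x = (Num.max (- f x) 0)%:E.
  by rewrite funenegE EFin_max EFinN.
congr (_ - _)%E.
  under eq_integral do rewrite posE.
  rewrite ge0_integral_normal_prob; last by move=> x; rewrite le_max lexx orbT.
    apply: eq_integral => x _.
    by rewrite funeposE -EFin_max maxr_pMl ?mul0r.
  exact: measurable_maxr.
under eq_integral do rewrite negE.
rewrite ge0_integral_normal_prob; last by move=> x; rewrite le_max lexx orbT.
  apply: eq_integral => x _.
  by rewrite funenegE -EFinN -EFin_max maxr_pMl ?mul0r ?mulNr.
by apply: measurable_maxr => //; exact: measurableT_comp.
Qed.

Lemma integral_itv_cvg (m : R) (f : R -> R) :
  mu.-integrable setT (fun x => (f x)%:E) ->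
  (fun n : nat => \int[mu]_(x in `[(m - n%:R)%R, (m + n%:R)%R]) (f x)%:E)%E
    @ \oo --> (\int[mu]_x (f x)%:E)%E.
Proof.
move=> fi; have mf := measurable_int mu fi.
pose I n : set R := [set` `[(m - n%:R)%R, (m + n%:R)%R]].
have : (fun n : nat => \int[mu]_x ((fun x => (f x)%:E) \_ (I n)) x)%E
    @ \oo --> (\int[mu]_x (f x)%:E)%E.
  have [] := @dominated_convergence _ _ R mu setT measurableT
    (fun n => (fun x => (f x)%:E) \_ (I n)) (fun x => (f x)%:E)
    (fun x => `|(f x)%:E|%E); try by [].
  - move=> n; apply: (measurable_restrictT _ _).1; first exact: measurable_itv.
    exact: measurable_funTS.
  - apply: aeW => x _; apply: cvg_near_cst; near=> n.
    rewrite patchE ifT// inE /I /= in_itv/= lerBlDl -lerBlDr -lerBlDl.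
    have : `|x - m| <= n%:R by near: n; exact: nbhs_infty_ger.
    by rewrite ler_norml => /andP[h1 h2]; rewrite h2 andbT; lra.
  - exact: integrable_abse.
  - apply: aeW => x n _; rewrite patchE; case: ifP => // _.
    by rewrite abse0.
under eq_fun do rewrite -integral_mkcond.
by [].
Unshelve. all: by end_near. Qed.

(** The fundamental theorem of calculus on growing intervals around [m], then dominated convergence:
    only boundary values of [F] remain. *)
Lemma integral_derive_eq0 (m : R) (F f : R -> R) :
  (forall x : R, is_derive x 1 F (f x)) -> continuous f ->
  mu.-integrable setT (fun x => (f x)%:E) ->
  (fun n : nat => F (m + n%:R) - F (m - n%:R)) @ \oo --> (0 : R) ->
  (\int[mu]_x (f x)%:E = 0)%E.
Proof.
move=> dF cf fi F0.
have dFx (x : R) : derivable F x 1 by have [] := dF x.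
have cF : continuous F by move=> x; apply: differentiable_continuous; exact/derivable1_diffP.
(* The shift to [n.+1] gives the interval positive length. *)
have FTC n : (\int[mu]_(x in `[(m - n.+1%:R)%R, (m + n.+1%:R)%R]) (f x)%:E =
    (F (m + n.+1%:R) - F (m - n.+1%:R))%:E)%E.
  rewrite (@continuous_FTC2 R f F) ?EFinB//.
  - by rewrite ltrD2l -subr_gt0 opprK addr_gt0// ltr0n.
  - exact: continuous_subspaceT.
  - by split=> [x _||]; [exact: dFx|apply: cvg_at_right_filter; exact: cF
     |apply: cvg_at_left_filter; exact: cF].
  - by move=> x _; rewrite derive1E; have /@derive_val -> := dF x.
have := integral_itv_cvg m fi; rewrite -cvg_shiftS/=.
under eq_fun do rewrite FTC.
move=> ci; apply: (cvg_unique _ ci) => //.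
apply: cvg_EFin; first exact: nearW.
by move: F0; rewrite -cvg_shiftS.
Qed.
End NormalIntegral.

(** * Central moments by integration by parts *)

Section NormalMoments.
Context {R : realType}.
Notation mu := (@lebesgue_measure R).
Variables (m s : R).
Hypothesis s0 : s != 0.

Let s2_gt0 : 0 < s ^+ 2. Proof. by rewrite exprn_even_gt0. Qed.

Let r := s * Num.sqrt 2.

Let r0 : r != 0.
Proof. by rewrite mulf_neq0// gt_eqF// sqrtr_gt0. Qed.

(** Half of the Gaussian exponent absorbs the power; the other half is the exponent of the density
    with deviation [r], of doubled variance. Integrability and boundedness for every power both
    follow. *)
Lemma pow_normal_pdf_le k : exists C : R, forall x : R,
  `|(x - m) ^+ k * normal_pdf m s x| <= C * normal_pdf m r x.
Proof.
(* [c] combines [|t|^k <= 1 + t^(2(k+1))], [t^2 = 4 s^2 y] and [y^(k+1) <= (k+1)! e^y]. *)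
pose c := 1 + (4 * s ^+ 2) ^+ k.+1 * (k.+1)`!%:R.
exists (normal_peak s * c / normal_peak r) => x.
rewrite !normal_pdfE// /normal_fun; set t := x - m.
pose y := t ^+ 2 / (4 * s ^+ 2).
have y0 : 0 <= y by rewrite divr_ge0 ?sqr_ge0// mulr_ge0// ltW.
have -> : - t ^+ 2 / (r ^+ 2 *+ 2) = - y.
  by rewrite /y exprMn sqr_sqrtr// -mulr_natr; field.
have -> : - t ^+ 2 / (s ^+ 2 *+ 2) = - y + - y.
  by rewrite /y -mulr_natr; field; rewrite s0.
rewrite expRD !normrM (ger0_norm (normal_peak_ge0 s)) !(ger0_norm (expR_ge0 _)).
have pr := normal_peak_gt0 r0.
have -> : normal_peak s * c / normal_peak r * (normal_peak r * expR (- y)) =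
  normal_peak s * expR (- y) * c.
  by field; rewrite gt_eqF.
rewrite [leLHS](_ : _ = normal_peak s * expR (- y) * (`|t ^+ k| * expR (- y)));
  last by ring.
apply: ler_wpM2l; first by rewrite mulr_ge0 ?normal_peak_ge0 ?expR_ge0.
rewrite expRN ler_pdivrMr ?expR_gt0// normrX.
have h1 : `|t| ^+ k <= 1 + (t ^+ 2) ^+ k.+1.
  rewrite -[t ^+ 2]real_normK ?num_real//.
  have [t1|t1] := leP `|t| 1.
    by rewrite (le_trans (exprn_ile1 k (normr_ge0 t) t1))// lerDl exprn_ge0// sqr_ge0.
  rewrite -exprM (@le_trans _ _ (`|t| ^+ (2 * k.+1)))//; last by rewrite lerDr.
  by apply: ler_weXn2l; [exact: ltW|rewrite mul2n -addnn addSn ltnW// ltnS leq_addr].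
apply: (le_trans h1).
have -> : t ^+ 2 = 4 * s ^+ 2 * y by rewrite /y; field; rewrite s0.
have e1 : 1 <= expR y by rewrite -expR0 ler_expR.
have f0 : (0 : R) < (k.+1)`!%:R by rewrite ltr0n fact_gt0.
have hy : y ^+ k.+1 <= (k.+1)`!%:R * expR y.
  rewrite mulrC -ler_pdivrMr//; apply: le_trans (expR_ge1Dxn k y0).
  by rewrite lerDr.
rewrite /c; move: (mulr_ge0 (ler0n R 4) (ltW s2_gt0)) => a0.
move: (4 * s ^+ 2) a0 => a a0; rewrite exprMn mulrDl mul1r -mulrA.
by rewrite lerD// ler_wpM2l// exprn_ge0.
Qed.

Lemma integrable_pow_normal_pdf k :
  mu.-integrable setT (fun x => ((x - m) ^+ k * normal_pdf m s x)%:E).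
Proof.
have [C hC] := pow_normal_pdf_le k.
have := integrableZl measurableT C (integrable_normal_pdf m r).
apply: le_integrable => //.
  apply/measurable_EFinP; apply: measurable_funM; last exact: measurable_normal_pdf.
  by apply: measurable_funX; apply: measurable_funB.
move=> x _; rewrite -EFinM !abse_EFin lee_fin.
by apply: le_trans (hC x) _; rewrite ler_norm.
Qed.

Lemma pow_normal_pdf_ub k : exists2 B : R, 0 <= B & forall x : R,
  `|(x - m) ^+ k * normal_pdf m s x| <= B.
Proof.
have [C hC] := pow_normal_pdf_le k.
exists (`|C| * normal_peak r); first by rewrite mulr_ge0 ?normal_peak_ge0.
move=> x; apply: (le_trans (hC x)).
apply: (@le_trans _ _ (`|C| * normal_pdf m r x)).
  by rewrite ler_wpM2r ?normal_pdf_ge0 ?ler_norm.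
by rewrite ler_wpM2l// normal_pdf_ub.
Qed.

Lemma is_derive_pow_normal_pdf k (x : R) :
  is_derive x 1 (fun x => (x - m) ^+ k * normal_pdf m s x)
   (k%:R * ((x - m) ^+ k.-1 * normal_pdf m s x)
    - s ^- 2 * ((x - m) ^+ k.+1 * normal_pdf m s x)).
Proof.
rewrite normal_pdfE// /normal_fun.
have dt : is_derive x 1 (fun x : R => x - m) 1.
  by apply: is_derive_eq; rewrite subr0.
have dX j : is_derive x 1 (fun x : R => (x - m) ^+ j) (j%:R * (x - m) ^+ j.-1).
  rewrite (_ : (fun x : R => (x - m) ^+ j) = (fun x : R => x - m) ^+ j).
    by apply: (is_derive_eq (is_deriveX j dt)); rewrite /GRing.scale /= mulr1.
  by apply/funext => z; rewrite exprfctE.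
pose g (x : R) := (- (s ^+ 2 *+ 2)^-1) * (x - m) ^+ 2.
have dg : is_derive x 1 g (- (s ^- 2) * (x - m)).
  apply: (is_derive_eq (is_deriveZ (- (s ^+ 2 *+ 2)^-1) (dX 2))).
  by rewrite /GRing.scale /= -mulr_natr; field; rewrite s0.
have de : is_derive x 1 (fun x => expR (g x)) (- (s ^- 2) * (x - m) * expR (g x)).
  apply: (is_derive_eq (@is_derive1_comp _ expR g x _ _ _ dg)).
  by rewrite mulrC.
have dM := is_deriveM (dX k) de.
have dZ := is_deriveZ (normal_peak s) dM.
have gE z : - (z - m) ^+ 2 / (s ^+ 2 *+ 2) = g z.
  by rewrite /g mulNr [_ / _]mulrC -mulNr.
rewrite [X in is_derive _ _ X](_ : _ =
    normal_peak s *: ((fun x => (x - m) ^+ k) * (fun x => expR (g x)))); last first.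
  by apply/funext => z; rewrite gE mulrCA.
apply: (is_derive_eq dZ); rewrite gE /GRing.scale /=.
by rewrite [(x - m) ^+ k.+1]exprS; ring.
Qed.

(** Stein's identity: the derivative of [(x - m) ^+ k * normal_pdf m s x] integrates to 0. At
    [k = 0] the coefficient kills the term with truncated exponent, so the first central moment
    vanishes. *)
Lemma normal_moment_rec k :
  (\int[normal_prob m s]_x ((x - m) ^+ k.+1)%:E =
   (s ^+ 2 * k%:R)%:E * \int[normal_prob m s]_x ((x - m) ^+ k.-1)%:E)%E.
Proof.
have mX j : measurable_fun setT (fun x : R => (x - m) ^+ j).
  by apply: measurable_funX; apply: measurable_funB.
rewrite !integral_normal_prob//.
pose f x := k%:R * ((x - m) ^+ k.-1 * normal_pdf m s x)
    - s ^- 2 * ((x - m) ^+ k.+1 * normal_pdf m s x).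
have i1 := integrableZl measurableT k%:R (integrable_pow_normal_pdf k.-1).
have i2 := integrableZl measurableT (s ^- 2) (integrable_pow_normal_pdf k.+1).
have fi : mu.-integrable setT (fun x => (f x)%:E).
  by apply: eq_integrable (integrableB measurableT i1 i2).
have cf : continuous f.
  have cX j : continuous (fun x : R => (x - m) ^+ j).
    move=> x; apply: (@continuous_comp _ _ _ (fun x => x - m) (fun y => y ^+ j)).
      by apply: cvgB; [exact: cvg_id|exact: cvg_cst].
    exact: exprn_continuous.
  have cN j : continuous (fun x : R => (x - m) ^+ j * normal_pdf m s x).
    by move=> x; apply: cvgM; [exact: cX|exact: continuous_normal_pdf].
  by move=> x; apply: cvgB; apply: cvgM; try exact: cvg_cst; exact: cN.
(* A bound for power [k.+1] makes the boundary term of power [k] decay like [1 / |x - m|]. *)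
have [B B0 hB] := pow_normal_pdf_ub k.+1.
have F0 : (fun n : nat => (m + n%:R - m) ^+ k * normal_pdf m s (m + n%:R)
    - (m - n%:R - m) ^+ k * normal_pdf m s (m - n%:R)) @ \oo --> (0 : R).
  rewrite -cvg_shiftS; apply/cvgr0Pnorm_le => e e0; near=> n.
  have n0 : (0 : R) < n.+1%:R by rewrite ltr0n.
  have b x : `|x - m| = n.+1%:R -> `|(x - m) ^+ k * normal_pdf m s x| <= B / n.+1%:R.
    move=> hx; rewrite ler_pdivlMr// -hx.
    by apply: le_trans (hB x); rewrite exprS -!normrM mulrC mulrA.
  apply: (le_trans (ler_normB _ _)).
  apply: (@le_trans _ _ (B / n.+1%:R + B / n.+1%:R)).
    apply: lerD; apply: b; first by rewrite addrC addKr ger0_norm// ltW.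
    by rewrite addrAC subrr add0r normrN ger0_norm// ltW.
  rewrite -mulrDl ler_pdivrMr// mulrC -ler_pdivrMr//.
  apply: (@le_trans _ _ n%:R); last by rewrite ler_nat.
  by near: n; exact: nbhs_infty_ger.
have := integral_derive_eq0 (is_derive_pow_normal_pdf k) cf fi F0.
under eq_integral do rewrite EFinB !EFinM.
rewrite integralB// !integralZl//;
  [|exact: integrable_pow_normal_pdf|exact: integrable_pow_normal_pdf].
have fin j := integrable_fin_num measurableT (integrable_pow_normal_pdf j).
rewrite -(fineK (fin k.-1)) -(fineK (fin k.+1)) -!EFinM -EFinB => -[].
move=> /eqP; rewrite subr_eq0 => /eqP h; congr (_%:E).
by rewrite -mulrA h mulrA divff ?mul1r// gt_eqF.
Unshelve. all: by end_near. Qed.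
End NormalMoments.

(** * Exact quadrature for functions polynomial in each coordinate *)

Section Quadrature.
Context {R : realType}.
Notation mu := (@lebesgue_measure R).

(* Nodes and weights of the three-point Gauss-Hermite rule: it has the moments of N(0,1) up to order 5. *)
Definition gnode (t : 'I_3) : R := [:: 0; Num.sqrt 3; - Num.sqrt 3]`_t.
Definition gweight (t : 'I_3) : R := [:: 2 / 3; 6^-1; 6^-1]`_t.

Lemma gweight_ge0 t : 0 <= gweight t.
Proof. by case: t => -[|[|[|//]]] /= ?; rewrite /gweight /= ?divr_ge0 ?invr_ge0. Qed.

Definition normal_moment (s : R) (k : nat) : R := [:: 1; 0; s ^+ 2; 0; 3 * s ^+ 4]`_k.

Lemma normal_momentE (m s : R) k : s != 0 -> (k < 5)%N ->
  (\int[normal_prob m s]_x ((x - m) ^+ k)%:E = (normal_moment s k)%:E)%E.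
Proof.
move=> s0.
have I0 : (\int[normal_prob m s]_x ((x - m) ^+ 0)%:E = 1)%E.
  rewrite integral_normal_prob; last exact: measurable_cst.
  by under eq_integral do rewrite expr0 mul1r; exact: integral_normal_pdf.
have I1 : (\int[normal_prob m s]_x ((x - m) ^+ 1)%:E = 0)%E.
  by rewrite normal_moment_rec// mulr0 mul0e.
have I2 : (\int[normal_prob m s]_x ((x - m) ^+ 2)%:E = (s ^+ 2)%:E)%E.
  by rewrite normal_moment_rec//= I0 mule1 mulr1.
case: k => [|[|[|[|[|//]]]]] _ //=.
- by rewrite normal_moment_rec//= I1 mule0.
- by rewrite normal_moment_rec//= I2 -EFinM; congr (_%:E); rewrite /normal_moment /=; ring.
Qed.

Lemma integral_poly_normal (m s : R) (q : {poly R}) : s != 0 -> (size q <= 5)%N ->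
  (\int[normal_prob m s]_x (q.[x])%:E
   = (\sum_t gweight t * q.[m + s * gnode t])%:E)%E.
Proof.
move=> s0 sq.
(* Recentring at [m] leaves only central moments up to order 4 to compare. *)
pose r := q \Po ('X + m%:P).
have sr : (size r <= 5)%N by rewrite size_comp_poly2 ?size_XaddC.
have qr x : q.[x] = \sum_(i < 5) r`_i * (x - m) ^+ i.
  rewrite -(horner_coef_wide _ sr) /r horner_comp hornerD hornerX hornerC.
  by rewrite subrK.
have mX j : measurable_fun setT (fun x : R => (x - m) ^+ j).
  by apply: measurable_funX; apply: measurable_funB.
have iX i := integrableZl measurableT r`_i (integrable_pow_normal_pdf m s0 i).
(* Integrability is carried along the induction because splitting the integral of the sum requires
   it. *)
have key n : (n <= 5)%N ->
    mu.-integrable setT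
      (fun x => ((\sum_(i < n) r`_i * (x - m) ^+ i) * normal_pdf m s x)%:E)
    /\ (\int[mu]_x ((\sum_(i < n) r`_i * (x - m) ^+ i) * normal_pdf m s x)%:E
      = (\sum_(i < n) r`_i * normal_moment s i)%:E)%E.
  elim: n => [_|n IHn ltn].
    have -> : (fun x => ((\sum_(i < 0) r`_i * (x - m) ^+ i) * normal_pdf m s x)%:E)
      = cst 0%E by apply/funext => x; rewrite big_ord0 mul0r.
    by rewrite big_ord0 integral0; split => //; exact: integrable0.
  have [i1 e1] := IHn (ltnW ltn).
  have E x : ((\sum_(i < n.+1) r`_i * (x - m) ^+ i) * normal_pdf m s x)%:E =
      (((\sum_(i < n) r`_i * (x - m) ^+ i) * normal_pdf m s x)%:E +
       (r`_n)%:E * ((x - m) ^+ n * normal_pdf m s x)%:E)%E.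
    by rewrite big_ord_recr/= mulrDl EFinD -EFinM mulrA.
  split.
    rewrite (_ : (fun x => _) = (fun x =>
        ((\sum_(i < n) r`_i * (x - m) ^+ i) * normal_pdf m s x)%:E +
        (r`_n)%:E * ((x - m) ^+ n * normal_pdf m s x)%:E)%E).
      exact: (integrableD measurableT i1 (iX n)).
    by apply/funext => x; exact: E.
  under eq_integral do rewrite E.
  rewrite integralD// e1 integralZl//; last exact: integrable_pow_normal_pdf.
  rewrite -integral_normal_prob// normal_momentE//.
  by rewrite -EFinM -EFinD big_ord_recr.
under eq_integral do rewrite qr.
rewrite integral_normal_prob; last first.
  by apply: measurable_sum => i; apply: measurable_funM => //; exact: measurable_cst.
have [_ ->] := key 5 (leqnn _); congr (_%:E).
under [RHS]eq_bigr do rewrite qr addrC addKr.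
have s3 : Num.sqrt 3 ^+ 2 = 3 :> R by rewrite sqr_sqrtr.
rewrite !big_ord_recr !big_ord0 /= /gweight /gnode /normal_moment /=.
have e2 : (s * Num.sqrt 3) ^+ 2 = 3 * s ^+ 2 by rewrite exprMn s3 mulrC.
have e2N : (s * - Num.sqrt 3) ^+ 2 = 3 * s ^+ 2 by rewrite mulrN sqrrN.
have x4 (x : R) : x ^+ 4 = (x ^+ 2) ^+ 2 by rewrite -exprM.
rewrite [(s * Num.sqrt 3) ^+ 4]x4 [(s * - Num.sqrt 3) ^+ 4]x4 e2 e2N.
by field.
Qed.

Definition deg_le (d : nat) (f : R -> R) :=
  exists2 q : {poly R}, (size q <= d.+1)%N & forall t, f t = q.[t].

Lemma deg_le_cst d c : deg_le d (fun=> c).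
Proof. by exists c%:P => [|t]; rewrite ?hornerC// (leq_trans (size_polyC_leq1 _)). Qed.

Lemma deg_le_ext d f g : f =1 g -> deg_le d f -> deg_le d g.
Proof. by move=> fg [q sq h]; exists q => // t; rewrite -fg. Qed.

Lemma deg_leW d e f : (d <= e)%N -> deg_le d f -> deg_le e f.
Proof. by move=> de [q sq h]; exists q => //; apply: leq_trans sq _. Qed.

Lemma deg_leD d f g : deg_le d f -> deg_le d g -> deg_le d (fun t => f t + g t).
Proof.
move=> [q sq fq] [r sr gr]; exists (q + r) => [|t]; last by rewrite hornerD fq gr.
by rewrite (leq_trans (size_polyD _ _))// geq_max sq.
Qed.

Lemma deg_leM d e f g :
  deg_le d f -> deg_le e g -> deg_le (d + e) (fun t => f t * g t).
Proof.
move=> [q sq fq] [r sr gr]; exists (q * r) => [|t]; last by rewrite hornerM fq gr.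
rewrite (leq_trans (size_polyMleq _ _))//.
by rewrite -subn1 leq_subLR (leq_trans (leq_add sq sr))// addSn addnS.
Qed.

Lemma deg_leZ d c f : deg_le d f -> deg_le d (fun t => c * f t).
Proof. by move=> h; have := deg_leM (deg_le_cst 0 c) h. Qed.

Lemma deg_leB d f g : deg_le d f -> deg_le d g -> deg_le d (fun t => f t - g t).
Proof.
move=> hf hg; apply: deg_leD => //.
by apply: deg_le_ext (deg_leZ (-1) hg) => t; rewrite mulN1r.
Qed.

Lemma deg_le_sum d (I : Type) (r : seq I) (P : pred I) (F : I -> R -> R) :
  (forall i, P i -> deg_le d (F i)) -> deg_le d (fun t => \sum_(i <- r | P i) F i t).
Proof.
move=> h; elim: r => [|i r IHr].
  by apply: deg_le_ext (deg_le_cst d 0) => t; rewrite big_nil.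
case Pi: (P i); last by apply: deg_le_ext IHr => t; rewrite big_cons Pi.
by apply: deg_le_ext (deg_leD (h i Pi) IHr) => t; rewrite big_cons Pi.
Qed.

Lemma deg_leX d k f : deg_le d f -> deg_le (k * d) (fun t => f t ^+ k).
Proof.
move=> h; elim: k => [|k IHk]; first exact: deg_le_cst.
by apply: deg_le_ext (deg_leM h IHk) => t; rewrite exprS.
Qed.

Lemma deg_le_affine a b : deg_le 1 (fun t => a + t * b).
Proof.
exists (a%:P + 'X * b%:P) => [|t]; last by rewrite !hornerE.
rewrite (leq_trans (size_polyD _ _))// geq_max (leq_trans (size_polyC_leq1 _))//.
rewrite (leq_trans (size_polyMleq _ _))// size_polyX.
by case: (size _) (size_polyC_leq1 b) => [|[]].
Qed.

(** The recursion copies that of [gaussN], so that one induction compares the two. *)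
Fixpoint quadN (m : seq R) (s : R) (f : seq R -> R) : R :=
  match m with
  | [::] => f [::]
  | m0 :: m' =>
      \sum_t gweight t * quadN m' s (fun u => f (m0 + s * gnode t :: u))
  end.

Lemma deg_le_quadN m s d (f : R -> seq R -> R) :
  (forall u, size u = size m -> deg_le d (f ^~ u)) ->
  deg_le d (fun t => quadN m s (f t)).
Proof.
elim: m f => [|m0 m IHm] f h /=; first exact: h.
apply: deg_le_sum => t _; apply: deg_leZ; apply: IHm => u su.
by apply: h; rewrite /= su.
Qed.

Definition coord_deg_le (d n : nat) (f : seq R -> R) :=
  forall a b, (size a + size b).+1 = n -> deg_le d (fun t => f (a ++ t :: b)).

Lemma coord_deg_le_cons d n f t :
  coord_deg_le d n.+1 f -> coord_deg_le d n (fun u => f (t :: u)).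
Proof. by move=> h a b e; apply: (h (t :: a) b); rewrite /= addSn e. Qed.

Lemma integral_deg_le m s f : s != 0 -> deg_le 4 f ->
  (\int[normal_prob m s]_x (f x)%:E
   = (\sum_t gweight t * f (m + s * gnode t))%:E)%E.
Proof.
move=> s0 [q sq fq]; under eq_integral do rewrite fq.
by rewrite integral_poly_normal//; under [in RHS]eq_bigr do rewrite fq.
Qed.

(** Induction on coordinates: the inner bound holds for each [t], monotonicity carries it through
    the outer integral, and it still has degree at most 4 in [t], so the outer integral is exactly a
    quadrature sum. *)
Lemma gaussN_le m s (A : set (seq R)) f : s != 0 -> coord_deg_le 4 (size m) f ->
  (forall u, \1_A u <= f u) -> (gaussN m s A <= (quadN m s f)%:E)%E.
Proof.
move=> s0; elim: m A f => [|m0 m IHm] A f df Af /=; first by rewrite lee_fin Af.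
rewrite -(@integral_deg_le m0 s (fun t => quadN m s (fun u => f (t :: u))))//.
  apply: le_integralT => t; apply: IHm; first exact: coord_deg_le_cons.
  by move=> u; apply: le_trans (Af (t :: u)).
by apply: deg_le_quadN => u su; apply: (df [::] u); rewrite /= su.
Qed.

Lemma gaussN_ge m s (A : set (seq R)) f : s != 0 -> coord_deg_le 4 (size m) f ->
  (forall u, f u <= \1_A u) -> ((quadN m s f)%:E <= gaussN m s A)%E.
Proof.
move=> s0; elim: m A f => [|m0 m IHm] A f df Af /=; first by rewrite lee_fin Af.
rewrite -(@integral_deg_le m0 s (fun t => quadN m s (fun u => f (t :: u))))//.
  apply: le_integralT => t; apply: IHm; first exact: coord_deg_le_cons.
  by move=> u; apply: le_trans (Af (t :: u)).
by apply: deg_le_quadN => u su; apply: (df [::] u); rewrite /= su.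
Qed.

End Quadrature.

(** * Quadrature as expectation on a finite product space *)

Section FiniteExpectation.
Context {R : realType}.

Definition is_dist (T : finType) (P : T -> R) :=
  (forall t, 0 <= P t) /\ \sum_t P t = 1.

Definition ex (T : finType) (P : T -> R) (f : T -> R) : R := \sum_t P t * f t.

Definition pw (I T : finType) (P : T -> R) (w : {ffun I -> T}) : R := \prod_i P (w i).

Definition upd (I T : finType) (w : {ffun I -> T}) (i : I) (t : T) : {ffun I -> T} :=
  [ffun j => if j == i then t else w j].

Section Basic.
Variables (T : finType) (P : T -> R).
Implicit Types f g : T -> R.

Lemma eq_ex f g : f =1 g -> ex P f = ex P g.
Proof. by move=> fg; apply: eq_bigr => t _; rewrite fg. Qed.

Lemma exD f g : ex P (fun t => f t + g t) = ex P f + ex P g.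
Proof. by rewrite -big_split; apply: eq_bigr => t _; rewrite mulrDr. Qed.

Lemma exZ c f : ex P (fun t => c * f t) = c * ex P f.
Proof. by rewrite mulr_sumr; apply: eq_bigr => t _; rewrite mulrCA. Qed.

Lemma exZr c f : ex P (fun t => f t * c) = ex P f * c.
Proof. by rewrite mulrC -exZ; apply: eq_ex => t; rewrite mulrC. Qed.

Lemma exB f g : ex P (fun t => f t - g t) = ex P f - ex P g.
Proof. by rewrite -sumrB; apply: eq_bigr => t _; rewrite mulrBr. Qed.

Lemma ex_sum (I : Type) (r : seq I) (p : pred I) (F : I -> T -> R) :
  ex P (fun t => \sum_(i <- r | p i) F i t) = \sum_(i <- r | p i) ex P (F i).
Proof.
by rewrite exchange_big; apply: eq_bigr => t _; rewrite mulr_sumr.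
Qed.

Lemma ex0 : ex P (fun=> 0) = 0.
Proof. by rewrite /ex big1// => t _; rewrite mulr0. Qed.

Hypothesis dP : is_dist P.

Lemma ex_cst c : ex P (fun=> c) = c.
Proof. by rewrite /ex -mulr_suml (proj2 dP) mul1r. Qed.

Lemma ler_ex f g : (forall t, f t <= g t) -> ex P f <= ex P g.
Proof. by move=> fg; apply: ler_sum => t _; rewrite ler_wpM2l// (proj1 dP). Qed.

Lemma ex_ge0 f : (forall t, 0 <= f t) -> 0 <= ex P f.
Proof. by move=> f0; apply: sumr_ge0 => t _; rewrite mulr_ge0// (proj1 dP). Qed.

End Basic.

Lemma is_dist_gweight : is_dist (@gweight R).
Proof.
split; first exact: gweight_ge0.
by rewrite !big_ord_recr big_ord0 /gweight /=; field.
Qed.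

Section Product.
Variables (I T : finType) (P : T -> R).
Hypothesis dP : is_dist P.
Implicit Types w : {ffun I -> T}.

Lemma is_dist_pw : is_dist (@pw I T P).
Proof.
split; first by move=> w; apply: prodr_ge0 => i _; exact: (proj1 dP).
by rewrite /pw -(bigA_distr_bigA (fun _ : I => P)) big1// => i _; exact: (proj2 dP).
Qed.

Lemma upd_eq w i t : upd w i t i = t. Proof. by rewrite ffunE eqxx. Qed.

Lemma upd_neq w i t j : j != i -> upd w i t j = w j.
Proof. by rewrite ffunE => /negPf ->. Qed.

(** Exchanging [w i] with a fresh draw [t] is an involution preserving the product weight. Redrawing
    a coordinate plays the role of conditioning on all the others. *)
Lemma ex_resample i f :
  ex (pw P) f = ex (pw P) (fun w => ex P (fun t => f (upd w i t))).
Proof.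
rewrite /ex; under [RHS]eq_bigr do rewrite mulr_sumr.
rewrite pair_bigA /=.
pose h (x : {ffun I -> T} * T) := (upd x.1 i x.2, x.1 i).
have hK : involutive h.
  move=> [w t]; rewrite /h /= upd_eq; congr (_, _).
  by apply/ffunP => j; rewrite !ffunE; case: eqP => // ->.
rewrite (reindex_inj (inv_inj hK)) /=.
have E w t : pw P (upd w i t) * P (w i) = pw P w * P t.
  rewrite /pw (bigD1 i)//= [in RHS](bigD1 i)//= upd_eq.
  under eq_bigr => j ji do rewrite upd_neq//.
  by ring.
rewrite -(pair_bigA _ (fun w t => pw P (upd w i t) *
  (P (w i) * f (upd (upd w i t) i (w i))))) /=.
apply: eq_bigr => w _; under eq_bigr => t _.
  rewrite mulrA E (_ : upd _ _ _ = w); first by over.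
  by apply/ffunP => j; rewrite !ffunE; case: eqP => // ->.
by rewrite -mulr_suml -mulr_sumr (proj2 dP) mulr1.
Qed.

End Product.

Lemma upd_cons_bij n (T : finType) :
  {on [pred _ : {ffun 'I_n.+1 -> T} | true], bijective
    (fun x : T * {ffun 'I_n -> T} =>
       [ffun i => if unlift ord0 i is Some j then x.2 j else x.1])}.
Proof.
exists (fun w => (w ord0, [ffun j => w (lift ord0 j)])) => [[t w] _|w _] /=.
  rewrite ffunE unlift_none; congr (_, _).
  by apply/ffunP => j; rewrite !ffunE liftK.
by apply/ffunP => i; rewrite !ffunE; case: unliftP => [j ->|->]; rewrite ?ffunE.
Qed.

Lemma quadNE n (m : seq R) s f : size m = n ->
  quadN m s f = ex (pw (@gweight R)) (fun w : {ffun 'I_n -> 'I_3} =>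
    f [seq nth 0 m (i : 'I_n) + s * gnode (w i) | i <- enum 'I_n]).
Proof.
elim: n m f => [[|//]|n IHn [//|m0 m]] f sm.
  rewrite /ex (big_pred1 [ffun=> ord0]); last first.
    by move=> w /=; apply/esym/eqP/ffunP => -[].
  by rewrite /pw big_ord0 mul1r (size0nil (size_enum_ord 0)).
rewrite /ex (reindex _ (upd_cons_bij n 'I_3)) /=.
rewrite -(pair_bigA _ (fun t w => pw (@gweight R) [ffun i => if unlift ord0 i is Some j then
   (w : {ffun 'I_n -> 'I_3}) j else t] * f [seq nth 0 (m0 :: m) (i : 'I_n.+1) + s * gnode
    ([ffun i => if unlift ord0 i is Some j then w j else t] i) | i <- enum 'I_n.+1])) /=.
have sm' : size m = n by case: sm.
apply: eq_bigr => t _; rewrite IHn// /ex mulr_sumr.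
apply: eq_bigr => w _; rewrite mulrA; congr (_ * f _).
  rewrite /pw big_ord_recl ffunE unlift_none; congr (_ * _).
  by apply: eq_bigr => j _; rewrite ffunE liftK.
rewrite enum_ordSl /= ffunE unlift_none; congr (_ :: _).
by rewrite -map_comp; apply: eq_map => j /=; rewrite ffunE liftK.
Qed.

(** The design law is that of one flat vector of length [n * p]; currying the index turns it into
    independent rows, which can be redrawn one at a time. *)
Lemma ex_pw_mxvec n p (P : 'I_3 -> R) (f : {ffun 'I_n -> {ffun 'I_p -> 'I_3}} -> R) :
  ex (pw P) (fun w : {ffun 'I_(n * p) -> 'I_3} =>
    f [ffun i => [ffun j => w (mxvec_index i j)]]) = ex (pw (pw P)) f.
Proof.
have [g gK' Kg'] := curry_mxvec_bij n p.
have gK i j : g (mxvec_index i j) = (i, j) by exact: (gK' (i, j)).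
have Kg k : mxvec_index (g k).1 (g k).2 = k.
  by have := Kg' k isT; case: (g k).
pose h (w : {ffun 'I_n -> {ffun 'I_p -> 'I_3}}) : {ffun 'I_(n * p) -> 'I_3} :=
  [ffun k => w (g k).1 (g k).2].
pose h' (v : {ffun 'I_(n * p) -> 'I_3}) := [ffun i => [ffun j => v (mxvec_index i j)]].
have hK : cancel h h'.
  move=> w; apply/ffunP => i; apply/ffunP => j; rewrite !ffunE.
  by rewrite gK.
have Kh : cancel h' h.
  move=> v; apply/ffunP => k; rewrite !ffunE.
  by rewrite Kg.
rewrite /ex (reindex h); last by exists h' => x _.
apply: eq_bigr => w _; congr (_ * f _); last exact: hK.
rewrite /pw pair_bigA (reindex (fun x : 'I_n * 'I_p => mxvec_index x.1 x.2)) /=.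
  by apply: eq_bigr => -[i j] _; rewrite ffunE; rewrite gK.
exists g => [[i j]|k] _; [exact: gK|exact: Kg].
Qed.

(** Varying one list entry becomes adding a multiple of a matrix unit, the form in which degrees in
    [X] and [Y] are stated. *)
Lemma seq_col_cat n (a b : seq R) t (ltn : (size a < n)%N) :
  seq_col n (a ++ t :: b) =
  seq_col n (a ++ 0 :: b) + t *: delta_mx (Ordinal ltn) 0.
Proof.
apply/matrixP => i j; rewrite !mxE ord1 eqxx andbT !nth_cat -val_eqE /=.
case: ltngtP => [ia|ia|ia]; rewrite ?mulr0 ?addr0//.
  by rewrite -(subnSK ia).
by rewrite ia subnn /= mulr1 add0r.
Qed.

Definition ycol n (mu : 'cV[R]_n) (s : R) (w : {ffun 'I_n -> 'I_3}) : 'cV[R]_n :=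
  \col_i (mu i 0 + s * gnode (w i)).

Definition gmx n p (w : {ffun 'I_n -> {ffun 'I_p -> 'I_3}}) : 'M[R]_(n, p) :=
  \matrix_(i, j) gnode (w i j).

Lemma seq_col_enum n (F : 'I_n -> R) : seq_col n [seq F i | i <- enum 'I_n] = \col_i F i.
Proof.
apply/matrixP => i j; rewrite !mxE (nth_map i) ?size_enum_ord//.
by rewrite nth_ord_enum.
Qed.

Lemma prY_le n (mu : 'cV[R]_n) (sigma2 : R) (E : set 'cV[R]_n) (f : 'cV[R]_n -> R) :
  0 < sigma2 ->
  (forall Y i, deg_le 4 (fun t => f (Y + t *: delta_mx i 0))) ->
  (forall Y, \1_E Y <= f Y) ->
  (prY mu sigma2 E <=
    (ex (pw (@gweight R)) (fun w => f (ycol mu (Num.sqrt sigma2) w)))%:E)%E.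
Proof.
move=> s0 df Ef; rewrite /prY.
have sz : size (col_seq mu) = n by rewrite size_map size_enum_ord.
apply: le_trans (gaussN_le _ (f := fun u => f (seq_col n u)) _ _) _.
- by rewrite gt_eqF// sqrtr_gt0.
- move=> a b; rewrite sz => e.
  have ltn : (size a < n)%N by rewrite -e ltnS leq_addr.
  by apply: deg_le_ext (df (seq_col n (a ++ 0 :: b)) (Ordinal ltn)) => t; rewrite -seq_col_cat.
- by move=> u; apply: le_trans (Ef (seq_col n u)).
rewrite lee_fin (quadNE _ _ sz); rewrite le_eqVlt; apply/orP; left; apply/eqP; apply: eq_ex => w.
rewrite seq_col_enum; congr f; apply/matrixP => i j; rewrite !mxE.
by rewrite (nth_map i) ?size_enum_ord// nth_ord_enum.
Qed.

(** A polynomial minorant replaces the passage to the complement of [A], which would need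
    additivity. *)
Lemma prX_ge n p (A : set 'M[R]_(n, p)) (f : 'M[R]_(n, p) -> R) :
  (forall X i j, deg_le 4 (fun t => f (X + t *: delta_mx i j))) ->
  (forall X, f X <= \1_A X) ->
  ((ex (pw (pw (@gweight R))) (fun w => f (gmx w)))%:E <= prX A)%E.
Proof.
move=> df Af; rewrite /prX.
have sz : size (nseq (n * p) (0 : R)) = (n * p)%N by rewrite size_nseq.
pose F u := f (vec_mx (trmx (seq_col (n * p) u))).
apply: le_trans _ (gaussN_ge _ (f := F) _ _).
- rewrite lee_fin (quadNE _ _ sz) -ex_pw_mxvec; rewrite le_eqVlt; apply/orP; left; apply/eqP; apply: eq_ex => w.
  rewrite /F seq_col_enum; congr f; apply/matrixP => i j; rewrite !mxE !ffunE.
  by rewrite nth_nseq if_same add0r mul1r.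
- exact: oner_neq0.
- move=> a b; rewrite sz => e.
  have ltn : (size a < n * p)%N by rewrite -e ltnS leq_addr.
  have := fun t => seq_col_cat b t ltn.
  case/mxvec_indexP: (Ordinal ltn) => i j h.
  apply: deg_le_ext (df (vec_mx (trmx (seq_col (n * p) (a ++ 0 :: b)))) i j) => t.
  by rewrite /F h linearD linearZ /= trmx_delta linearD linearZ /= vec_mx_delta.
- by move=> u; apply: le_trans (Af _) _.
Qed.

(** Supplies the upper side of the squeeze for the probability of the good designs; again
    monotonicity suffices. *)
Lemma gaussN_le1 m (A : set (seq R)) (s : R) : (gaussN m s A <= 1)%E.
Proof.
elim: m A => [|m0 m IHm] A /=; first by rewrite lee_fin indicE lern1 leq_b1.
apply: (@le_trans _ _ (\int[normal_prob m0 s]_x 1)%E); first exact: le_integralT.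
have N1 : normal_prob m0 s setT = 1%E := probability_setT (normal_prob m0 s).
by rewrite integral_cst//= mul1e N1.
Qed.

End FiniteExpectation.
Arguments ex0 {R T} P.

(** * Second moments of sums on product spaces *)

Section SecondMoments.
Context {R : realType}.

(* The involution sg lets Z_(i,j) correlate with Z_(j,i); with sg = id the Z_a are uncorrelated. *)
Lemma ex_sqr_sum_le (T A : finType) (P : T -> R) (D : pred A) (sg : A -> A)
    (Z : A -> T -> R) :
  is_dist P -> involutive sg -> (forall a, D (sg a) = D a) ->
  (forall a b, D a -> D b -> b != a -> b != sg a ->
     ex P (fun t => Z a t * Z b t) = 0) ->
  ex P (fun t => (\sum_(a | D a) Z a t) ^+ 2)
    <= 2 * \sum_(a | D a) ex P (fun t => Z a t ^+ 2).
Proof.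
move=> dP sgK Dsg Z0; pose S a := ex P (fun t => Z a t ^+ 2).
have S0 a : 0 <= S a by apply: ex_ge0 => // t; exact: sqr_ge0.
have -> : ex P (fun t => (\sum_(a | D a) Z a t) ^+ 2) =
    \sum_(a | D a) \sum_(b | D b) ex P (fun t => Z a t * Z b t).
  under eq_bigr => a _ do rewrite -ex_sum.
  rewrite -ex_sum; apply: eq_ex => t; rewrite expr2 mulr_suml.
  by apply: eq_bigr => a _; rewrite mulr_sumr.
have b1 a b : D a -> D b -> ex P (fun t => Z a t * Z b t) <=
   (if b == a then S a else 0) + (if b == sg a then (S a + S b) / 2 else 0).
  move=> Da Db.
  have hS : ex P (fun t => Z a t * Z b t) <= (S a + S b) / 2.
    rewrite -exD -exZr; apply: ler_ex => // t.
    by have := sqr_ge0 (Z a t - Z b t); lra.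
  case: (eqVneq b a) => [E|ba].
    apply: (@le_trans _ _ (S a)).
      by rewrite E; apply: ler_ex => // t; rewrite expr2.
    by rewrite lerDl; case: ifP => // _; rewrite divr_ge0// addr_ge0.
  case: (eqVneq b (sg a)) => [E|bs]; first by rewrite add0r.
  by rewrite Z0// addr0.
apply: (@le_trans _ _ (\sum_(a | D a) (S a + (S a + S (sg a)) / 2))).
  apply: ler_sum => a Da.
  apply: (@le_trans _ _ (\sum_(b | D b) ((if b == a then S a else 0) +
     (if b == sg a then (S a + S b) / 2 else 0)))).
    by apply: ler_sum => b Db; exact: b1.
  rewrite big_split /= -!big_mkcondr /=.
  rewrite (big_pred1 a); last first.
    by move=> b /=; case: eqP => [->|_]; rewrite ?Da ?andbF.
  rewrite (big_pred1 (sg a))//.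
  by move=> b /=; case: eqP => [->|_]; rewrite ?Dsg ?Da ?andbF.
rewrite big_split /= -mulr_suml big_split /=.
have -> : \sum_(a | D a) S (sg a) = \sum_(a | D a) S a.
  rewrite [RHS](reindex_inj (inv_inj sgK)).
  by apply: eq_bigl => a; rewrite Dsg.
by rewrite -/S; lra.
Qed.

End SecondMoments.

Section ProductMoments.
Context {R : realType}.
Variables (I T : finType) (P : T -> R).
Hypothesis dP : is_dist P.
Let dpw := @is_dist_pw R I T P dP.

Lemma ex_pw1 i (f : T -> R) : ex (pw P) (fun w : {ffun I -> T} => f (w i)) = ex P f.
Proof.
rewrite (ex_resample dP i) -[RHS](ex_cst dpw); apply: eq_ex => w.
by apply: eq_ex => t; rewrite upd_eq.
Qed.

Lemma ex_pw2 i j (f : T -> T -> R) : i != j ->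
  ex (pw P) (fun w : {ffun I -> T} => f (w i) (w j))
    = ex P (fun x => ex P (fun y => f x y)).
Proof.
move=> ij; rewrite (ex_resample dP j).
under eq_ex => w do under eq_ex => t do rewrite upd_eq upd_neq//.
by rewrite (ex_pw1 i (fun x => ex P (f x))).
Qed.

Lemma ex_pw_sqr_sum_le (f : I -> T -> R) : (forall i, ex P (f i) = 0) ->
  ex (pw P) (fun w : {ffun I -> T} => (\sum_i f i (w i)) ^+ 2)
    <= 2 * \sum_i ex P (fun t => f i t ^+ 2).
Proof.
move=> f0; under [in leRHS]eq_bigr => i _ do rewrite -(ex_pw1 i).
apply: (ex_sqr_sum_le (sg := id)) => // i j _ _ ji _.
rewrite (ex_pw2 (fun x y => f i x * f j y)) 1?eq_sym//.
by under eq_ex do rewrite exZ f0 mulr0; exact: ex0.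
Qed.

(** The variance bound for a degenerate U-statistic: if two pairs of indices are neither equal nor
    swapped, the second has an index outside the first, and redrawing it gives 0. *)
Lemma ex_pw_kernel_le (h : I -> I -> T -> T -> R) :
  (forall i j x, ex P (h i j x) = 0) ->
  (forall i j y, ex P (fun x => h i j x y) = 0) ->
  ex (pw P) (fun w : {ffun I -> T} => (\sum_i \sum_(j | j != i) h i j (w i) (w j)) ^+ 2)
    <= 2 * \sum_i \sum_(j | j != i) ex P (fun x => ex P (fun y => h i j x y ^+ 2)).
Proof.
move=> h1 h2.
pose Z (a : I * I) (w : {ffun I -> T}) := h a.1 a.2 (w a.1) (w a.2).
pose D (a : I * I) := a.2 != a.1.
have -> : \sum_i \sum_(j | j != i) ex P (fun x => ex P (fun y => h i j x y ^+ 2))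
    = \sum_(a | D a) ex (pw P) (fun w => Z a w ^+ 2).
  rewrite pair_big_dep /=; apply: eq_bigr => -[i j] ij.
  by rewrite /Z (ex_pw2 (fun x y => h i j x y ^+ 2)) 1?eq_sym.
under eq_ex => w do rewrite pair_big_dep /=.
apply: (ex_sqr_sum_le (sg := fun a : I * I => (a.2, a.1))) => //.
- by case.
- by move=> [i j]; rewrite /D /= eq_sym.
move=> [i j] [k l]; rewrite /D /Z /= => ij kl ne1 ne2.
have [/andP[ki kj]|] := boolP ((k != i) && (k != j)).
  have [ik jk] : i != k /\ j != k by rewrite ![_ == k]eq_sym.
  rewrite (ex_resample dP k) -[RHS](ex0 (@pw R I T P)); apply: eq_ex => w.
  under eq_ex => t do rewrite !(upd_eq, upd_neq w t ik, upd_neq w t jk, upd_neq w t kl).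
  by rewrite exZ h2 mulr0.
rewrite negb_and !negbK => kij.
(* With [k] in the first pair, [l] cannot be there too: [(k, l)] would be [(i, j)] or [(j, i)]. *)
have [li lj] : l != i /\ l != j.
  move: ne1 ne2; rewrite !xpair_eqE.
  case/orP: kij => /eqP E; subst k; rewrite eqxx /=.
    by rewrite kl.
  by rewrite kl => _ ->.
have [il jl] : i != l /\ j != l by rewrite ![_ == l]eq_sym.
have kl' : k != l by rewrite eq_sym.
rewrite (ex_resample dP l) -[RHS](ex0 (@pw R I T P)); apply: eq_ex => w.
under eq_ex => t do rewrite !(upd_eq, upd_neq w t il, upd_neq w t jl, upd_neq w t kl').
by rewrite exZ h1 mulr0.
Qed.

End ProductMoments.

(** * Moments of the nodes and of their quadratic forms *)

Section NodeMoments.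
Context {R : realType}.
Notation g := (@gweight R).

Let s3 : Num.sqrt 3 ^+ 2 = 3 :> R. Proof. by rewrite sqr_sqrtr. Qed.

Lemma ex_gnode : ex g gnode = 0.
Proof. by rewrite /ex !big_ord_recr big_ord0 /gweight /gnode /=; ring. Qed.

Lemma ex_gnode2 : ex g (fun t => gnode t ^+ 2) = 1.
Proof.
rewrite /ex !big_ord_recr big_ord0 /gweight /gnode /= sqrrN s3.
by field.
Qed.

Lemma ex_gnode2_centered : ex g (fun t => gnode t ^+ 2 - 1) = 0.
Proof. by rewrite exB ex_gnode2 ex_cst ?subrr//; exact: is_dist_gweight. Qed.

Lemma ex_gnode2_var : ex g (fun t => (gnode t ^+ 2 - 1) ^+ 2) = 2.
Proof.
rewrite /ex !big_ord_recr big_ord0 /gweight /gnode /= sqrrN s3.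
by field.
Qed.

(** The off-diagonal part is a degenerate kernel, bounded with factor 2; the diagonal part is a sum
    of centred terms of variance 2, bounded with factor 4. Splitting the square doubles both
    factors, and 8 covers them. *)
Lemma ex_quadratic_form (I : finType) (M : I -> I -> R) :
  ex (pw g) (fun w : {ffun I -> 'I_3} =>
    (\sum_i \sum_j M i j * (gnode (w i) * gnode (w j)) - \sum_i M i i) ^+ 2)
  <= 8 * \sum_i \sum_j M i j ^+ 2.
Proof.
have dg := @is_dist_gweight R.
have dp := @is_dist_pw R I _ _ dg.
pose A (w : {ffun I -> 'I_3}) :=
  \sum_i \sum_(j | j != i) M i j * (gnode (w i) * gnode (w j)).
pose B (w : {ffun I -> 'I_3}) := \sum_i M i i * (gnode (w i) ^+ 2 - 1).
have AB (w : {ffun I -> 'I_3}) : \sum_i \sum_j M i j * (gnode (w i) * gnode (w j)) - \sum_i M i i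
    = A w + B w.
  rewrite -sumrB -big_split /=; apply: eq_bigr => i _.
  by rewrite (bigD1 i)//= -expr2; ring.
apply: (@le_trans _ _ (ex (pw g) (fun w : {ffun I -> 'I_3} => 2 * A w ^+ 2 + 2 * B w ^+ 2))).
  apply: ler_ex => // w; rewrite AB.
  by have := sqr_ge0 (A w - B w); lra.
rewrite exD !exZ.
have hA : ex (pw g) (fun w : {ffun I -> 'I_3} => A w ^+ 2) <= 2 * \sum_i \sum_(j | j != i) M i j ^+ 2.
  apply: le_trans (ex_pw_kernel_le dg (h := fun i j x y => M i j * (gnode x * gnode y)) _ _) _.
  - by move=> i j x; rewrite exZ exZ ex_gnode !mulr0.
  - by move=> i j y; rewrite exZ exZr ex_gnode mul0r mulr0.
  rewrite ler_wpM2l//; apply: ler_sum => i _; apply: ler_sum => j _.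
  under eq_ex => x do under eq_ex => y do rewrite exprMn exprMn.
  under eq_ex => x do rewrite !exZ ex_gnode2 mulr1.
  by rewrite exZ ex_gnode2 mulr1.
have hB : ex (pw g) (fun w : {ffun I -> 'I_3} => B w ^+ 2) <= 4 * \sum_i M i i ^+ 2.
  apply: le_trans (ex_pw_sqr_sum_le dg (f := fun i x => M i i * (gnode x ^+ 2 - 1)) _) _.
    by move=> i; rewrite exZ ex_gnode2_centered mulr0.
  rewrite [4 * _](_ : _ = 2 * (2 * \sum_i M i i ^+ 2)); last by ring.
  rewrite ler_wpM2l// mulr_sumr; apply: ler_sum => i _.
  under eq_ex do rewrite exprMn.
  by rewrite exZ ex_gnode2_var mulrC.
have -> : \sum_i \sum_j M i j ^+ 2 =
    \sum_i M i i ^+ 2 + \sum_i \sum_(j | j != i) M i j ^+ 2.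
  by rewrite -big_split /=; apply: eq_bigr => i _; rewrite (bigD1 i).
have : 0 <= \sum_i \sum_(j | j != i) M i j ^+ 2.
  by apply: sumr_ge0 => i _; apply: sumr_ge0 => j _; exact: sqr_ge0.
by move: hA hB; lra.
Qed.

End NodeMoments.

(** * Expected sizes of the six statistics *)

Section RowStatistics.
Context {R : realType}.
Variables (n p : nat) (beta : 'cV[R]_p).
Implicit Types (x y : 'I_p -> R) (X : 'I_n -> 'I_p -> R).

Definition dot x y : R := \sum_k x k * y k.
Definition row_lin x : R := \sum_k x k * beta k 0.
Definition row_dev x : R := \sum_k x k ^+ 2 - p%:R.
(** Centred at the mean [beta k 0] of [row_lin x * x k], which makes the pair sums below
    degenerate. *)
Definition row_err x (k : 'I_p) : R := row_lin x * x k - beta k 0.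

Definition stat_dev X := \sum_i row_dev (X i) ^+ 2.
Definition stat_lin4 X := \sum_i row_lin (X i) ^+ 4.
Definition stat_lin2 X := \sum_i (row_lin (X i) ^+ 2 - sqnorm beta).
(** The diagonal is left out: in general it has nonzero mean, and its square would have degree 8 in
    one entry. *)
Definition stat_err X := \sum_i \sum_(j | j != i) dot (row_err (X i)) (row_err (X j)).
Definition stat_gram X := \sum_i \sum_j dot (X i) (X j) ^+ 2.
Definition stat_cross X := \sum_i (\sum_(j | j != i) dot (X i) (row_err (X j))) ^+ 2.

Lemma sqnorm_ge0 k (v : 'cV[R]_k) : 0 <= sqnorm v.
Proof. by apply: sumr_ge0 => i _; exact: sqr_ge0. Qed.

Notation tau2 := (sqnorm beta).

Lemma dot_row_err x y :
  dot x (row_err y) = row_lin y * dot x y - \sum_k x k * beta k 0.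
Proof.
rewrite /dot mulr_sumr -sumrB; apply: eq_bigr => k _.
by rewrite /row_err; ring.
Qed.

(** Exhibits the fluctuation of the squared linear form as a projection of [row_err], so its mean
    and variance come from [ex_dot_row_err] and [ex_dot_row_err2]. *)
Lemma row_lin2E x : row_lin x ^+ 2 - tau2 = dot (fun k => beta k 0) (row_err x).
Proof.
rewrite dot_row_err; congr (_ - _).
by rewrite expr2; congr (_ * _); apply: eq_bigr => k _; rewrite mulrC.
Qed.

Notation T := {ffun 'I_p -> 'I_3}.
Notation g := (@gweight R).
Definition rnode (x : T) (k : 'I_p) : R := gnode (x k).

Let dg := @is_dist_gweight R.
Let dr := @is_dist_pw R 'I_p _ _ dg.
Let dX := @is_dist_pw R 'I_n _ _ dr.

Lemma ex_rnode2 k l : ex (pw g) (fun x : T => rnode x k * rnode x l) = (k == l)%:R.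
Proof.
case: eqVneq => [->|kl]; last first.
  rewrite (ex_pw2 dg (fun a b => gnode a * gnode b) kl).
  by under eq_ex do rewrite exZ ex_gnode mulr0; rewrite ex0.
by rewrite (ex_pw1 dg l (fun a => gnode a * gnode a)) -ex_gnode2.
Qed.

(** [row_dev] is the quadratic form of the identity matrix minus its trace. *)
Lemma ex_row_dev2 : ex (pw g) (fun x : T => row_dev (rnode x) ^+ 2) <= 8 * p%:R.
Proof.
have := @ex_quadratic_form R 'I_p (fun i j => (i == j)%:R).
have S (F : 'I_p -> 'I_p -> R) i : \sum_j (i == j)%:R * F i j = F i i.
  rewrite (bigD1 i)//= eqxx mul1r big1 ?addr0// => j ji.
  by rewrite eq_sym (negPf ji) mul0r.
have -> : \sum_(i < p) \sum_(j < p) ((i == j)%:R : R) ^+ 2 = p%:R :> R.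
  transitivity (\sum_(i < p) (1 : R)); last by rewrite sumr_const card_ord.
  apply: eq_bigr => i _; by under eq_bigr do rewrite expr2; rewrite (S (fun i j => (i == j)%:R)) eqxx.
apply: le_trans; apply: ler_ex => // x; rewrite le_eqVlt; apply/orP; left; apply/eqP.
congr ((_ - _) ^+ 2).
  by apply: eq_bigr => i _; rewrite (S (fun i j => gnode (x i) * gnode (x j))) expr2.
by under eq_bigr do rewrite eqxx; rewrite sumr_const card_ord.
Qed.

(* As dot a (row_err x) = (beta . x) (a . x) - beta . a, this is the quadratic form of the matrix beta a^T. *)
Lemma ex_dot_row_err2 (a : 'I_p -> R) :
  ex (pw g) (fun x : T => dot a (row_err (rnode x)) ^+ 2) <= 8 * (tau2 * dot a a).
Proof.
have := @ex_quadratic_form R 'I_p (fun i j => beta i 0 * a j).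
have -> : \sum_i \sum_j (beta i 0 * a j) ^+ 2 = tau2 * dot a a.
  rewrite /sqnorm mulr_suml; apply: eq_bigr => i _; rewrite mulr_sumr.
  by apply: eq_bigr => j _; ring.
apply: le_trans; apply: ler_ex => // x; rewrite le_eqVlt; apply/orP; left; apply/eqP.
rewrite dot_row_err; congr ((_ - _) ^+ 2); last by apply: eq_bigr => i _; rewrite mulrC.
rewrite /row_lin mulr_suml; apply: eq_bigr => i _; rewrite /dot mulr_sumr.
by apply: eq_bigr => j _; rewrite /rnode; ring.
Qed.

Lemma ex_row_err k : ex (pw g) (fun x : T => row_err (rnode x) k) = 0.
Proof.
rewrite exB ex_cst// /row_lin.
under eq_ex do rewrite mulr_suml.
rewrite ex_sum (bigD1 k)//= big1 ?addr0 => [|l lk].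
  under eq_ex do rewrite mulrAC.
  by rewrite exZr ex_rnode2 eqxx mul1r subrr.
under eq_ex do rewrite mulrAC.
by rewrite exZr ex_rnode2 (negPf lk) mul0r.
Qed.

Lemma ex_dot_row_err (a : 'I_p -> R) : ex (pw g) (fun x : T => dot a (row_err (rnode x))) = 0.
Proof.
rewrite ex_sum big1// => k _.
by rewrite exZ ex_row_err mulr0.
Qed.

Lemma ex_row_lin2_var :
  ex (pw g) (fun x : T => (row_lin (rnode x) ^+ 2 - tau2) ^+ 2) <= 8 * tau2 ^+ 2.
Proof.
under eq_ex do rewrite row_lin2E.
by apply: le_trans (ex_dot_row_err2 _) _; rewrite expr2.
Qed.

(** From [v^4 <= 2 (v^2 - tau2)^2 + 2 tau2^2] and the variance bound 8: the constant is 2 times 8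
    plus 2. *)
Lemma ex_row_lin4 : ex (pw g) (fun x : T => row_lin (rnode x) ^+ 4) <= 18 * tau2 ^+ 2.
Proof.
apply: (@le_trans _ _ (ex (pw g) (fun x : T =>
   2 * (row_lin (rnode x) ^+ 2 - tau2) ^+ 2 + 2 * tau2 ^+ 2))).
  apply: ler_ex => // x; set a := row_lin _.
  by have := sqr_ge0 (a ^+ 2 - 2 * tau2); rewrite !expr2; nra.
by rewrite exD exZ ex_cst//; have := ex_row_lin2_var; lra.
Qed.

Lemma ex_dot2 (a : 'I_p -> R) : ex (pw g) (fun x : T => dot a (rnode x) ^+ 2) <= 2 * dot a a.
Proof.
apply: le_trans (ex_pw_sqr_sum_le dg (f := fun k t => a k * gnode t) _) _.
  by move=> i; rewrite exZ ex_gnode mulr0.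
rewrite ler_wpM2l//; apply: ler_sum => k _.
by under eq_ex do rewrite exprMn; rewrite exZ ex_gnode2 mulr1 expr2.
Qed.

Lemma ex_dot_diag : ex (pw g) (fun x : T => dot (rnode x) (rnode x)) = p%:R.
Proof.
transitivity (\sum_(i < p) (1 : R)); last by rewrite sumr_const card_ord.
rewrite ex_sum; apply: eq_bigr => k _.
by rewrite ex_rnode2 eqxx.
Qed.

(** Each coordinate of [row_err] is its product with a unit vector, to which [ex_dot_row_err2]
    applies. *)
Lemma ex_row_err_norm :
  ex (pw g) (fun x : T => dot (row_err (rnode x)) (row_err (rnode x))) <= 8 * (tau2 * p%:R).
Proof.
rewrite ex_sum [leRHS](_ : _ = \sum_(k < p) 8 * tau2); last first.
  by rewrite sumr_const card_ord -[RHS]mulr_natr; ring.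
apply: ler_sum => k _.
have := ex_dot_row_err2 (fun l => (l == k)%:R).
have S (F : 'I_p -> R) : dot (fun l => (l == k)%:R) F = F k.
  rewrite /dot (bigD1 k)//= eqxx mul1r big1 ?addr0// => j ji.
  by rewrite (negPf ji) mul0r.
rewrite S eqxx mulr1; apply: le_trans.
by apply: ler_ex => // x; rewrite S expr2.
Qed.

Notation W := {ffun 'I_n -> T}.
Notation Xw w := (fun i => rnode (w i)).

Lemma sum_ord_const k (c : R) : \sum_(i < k) c = k%:R * c.
Proof. by rewrite sumr_const card_ord mulr_natl. Qed.

Lemma ex_stat_dev : ex (pw (pw g)) (fun w : W => stat_dev (Xw w)) <= 8 * (n%:R * p%:R).
Proof.
rewrite ex_sum; under eq_bigr => i _ do rewrite (ex_pw1 dr i (fun x : T => row_dev (rnode x) ^+ 2)).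
by rewrite sum_ord_const mulrCA ler_wpM2l// ex_row_dev2.
Qed.

Lemma ex_stat_lin4 :
  ex (pw (pw g)) (fun w : W => stat_lin4 (Xw w)) <= 18 * (n%:R * tau2 ^+ 2).
Proof.
rewrite ex_sum; under eq_bigr => i _ do rewrite (ex_pw1 dr i (fun x : T => row_lin (rnode x) ^+ 4)).
by rewrite sum_ord_const mulrCA ler_wpM2l// ex_row_lin4.
Qed.

Lemma ex_stat_lin2 :
  ex (pw (pw g)) (fun w : W => stat_lin2 (Xw w) ^+ 2) <= 16 * (n%:R * tau2 ^+ 2).
Proof.
apply: le_trans (ex_pw_sqr_sum_le dr (f := fun _ (x : T) => row_lin (rnode x) ^+ 2 - tau2) _) _.
  by move=> _; under eq_ex do rewrite row_lin2E; exact: ex_dot_row_err.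
rewrite sum_ord_const.
rewrite [leRHS](_ : _ = 2 * (n%:R * (8 * tau2 ^+ 2))); last by ring.
by rewrite !ler_wpM2l// ex_row_lin2_var.
Qed.

Lemma sum_ord_neq_le (F : 'I_n -> 'I_n -> R) (c : R) :
  0 <= c -> (forall i j, j != i -> F i j <= c) ->
  \sum_i \sum_(j | j != i) F i j <= n%:R ^+ 2 * c.
Proof.
move=> c0 Fc; apply: (@le_trans _ _ (\sum_(i < n) \sum_(j < n) c)).
  apply: ler_sum => i _; rewrite big_mkcond; apply: ler_sum => j _.
  by case: ifP => // ji; exact: Fc.
by rewrite !sum_ord_const mulrA expr2.
Qed.

Lemma ex_stat_err : ex (pw (pw g)) (fun w : W => stat_err (Xw w) ^+ 2)
  <= 128 * (n%:R ^+ 2 * (tau2 ^+ 2 * p%:R)).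
Proof.
have t0 := sqnorm_ge0 beta.
apply: le_trans (ex_pw_kernel_le dr
  (h := fun _ _ (x y : T) => dot (row_err (rnode x)) (row_err (rnode y))) _ _) _.
- by move=> _ _ x; exact: ex_dot_row_err.
- move=> _ _ y; rewrite -(ex_dot_row_err (row_err (rnode y))); apply: eq_ex => x.
  by apply: eq_bigr => k _; rewrite mulrC.
rewrite [leRHS](_ : _ = 2 * (n%:R ^+ 2 * (64 * (tau2 ^+ 2 * p%:R)))); last by ring.
rewrite ler_wpM2l//; apply: sum_ord_neq_le; first by rewrite !mulr_ge0// sqr_ge0.
move=> _ _ _; apply: (@le_trans _ _ (ex (pw g) (fun x : T =>
    8 * tau2 * dot (row_err (rnode x)) (row_err (rnode x))))).
  by apply: ler_ex => // x; rewrite -mulrA; exact: ex_dot_row_err2.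
rewrite exZ [leRHS](_ : _ = 8 * tau2 * (8 * (tau2 * p%:R))); last by ring.
by rewrite ler_wpM2l ?mulr_ge0// ex_row_err_norm.
Qed.

(** With row [i] held fixed the terms over [j != i] are uncorrelated: redrawing row [l] annihilates
    the factor that contains it. *)
Lemma ex_stat_cross : ex (pw (pw g)) (fun w : W => stat_cross (Xw w))
  <= 16 * (n%:R ^+ 2 * (tau2 * p%:R)).
Proof.
have t0 := sqnorm_ge0 beta.
rewrite ex_sum [leRHS](_ : _ = n%:R ^+ 2 * (16 * (tau2 * p%:R))); last by ring.
apply: (@le_trans _ _ (\sum_(i < n) \sum_(j < n | j != i) (16 * (tau2 * p%:R)))); last first.
  by apply: sum_ord_neq_le => //; rewrite !mulr_ge0.
apply: ler_sum => i _.
apply: le_trans (ex_sqr_sum_le (sg := id)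
  (Z := fun j (w : W) => dot (rnode (w i)) (row_err (rnode (w j)))) dX _ _ _) _ => //.
  move=> j l ji li lj _; have [jl il] : j != l /\ i != l by rewrite ![_ == l]eq_sym.
  rewrite (ex_resample dr l) -[RHS](ex0 (@pw R 'I_n T (pw g))); apply: eq_ex => w.
  under eq_ex => t do rewrite upd_eq !(upd_neq w t jl, upd_neq w t il).
  by rewrite exZ ex_dot_row_err mulr0.
rewrite mulr_sumr; apply: ler_sum => j ji.
rewrite (ex_pw2 dr (fun x y : T => dot (rnode x) (row_err (rnode y)) ^+ 2)) 1?eq_sym//.
rewrite [leRHS](_ : _ = 2 * (8 * tau2 * p%:R)); last by ring.
rewrite ler_wpM2l// -ex_dot_diag -exZ.
by apply: ler_ex => // x; rewrite -mulrA; exact: ex_dot_row_err2.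
Qed.

(** Diagonal and off-diagonal terms weigh the same when p is of order n: n squared norms of size p^2
    against n^2 squared products of size p. *)
Lemma ex_stat_gram : ex (pw (pw g)) (fun w : W => stat_gram (Xw w))
  <= n%:R ^+ 2 * (2 * p%:R) + n%:R * (16 * p%:R + 2 * p%:R ^+ 2).
Proof.
have -> : ex (pw (pw g)) (fun w : W => stat_gram (Xw w)) =
   \sum_i \sum_(j | j != i) ex (pw (pw g)) (fun w : W => dot (rnode (w i)) (rnode (w j)) ^+ 2)
   + \sum_i ex (pw (pw g)) (fun w : W => dot (rnode (w i)) (rnode (w i)) ^+ 2).
  rewrite ex_sum -big_split; apply: eq_bigr => i _ /=.
  by rewrite ex_sum (bigD1 i)//= addrC.
apply: lerD.
  apply: sum_ord_neq_le; first by rewrite mulr_ge0.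
  move=> i j ji; rewrite (ex_pw2 dr (fun x y : T => dot (rnode x) (rnode y) ^+ 2)) 1?eq_sym//.
  by rewrite -ex_dot_diag -exZ; apply: ler_ex => // x; exact: ex_dot2.
under eq_bigr => i _ do rewrite (ex_pw1 dr i (fun x : T => dot (rnode x) (rnode x) ^+ 2)).
rewrite sum_ord_const ler_wpM2l//.
apply: (@le_trans _ _ (ex (pw g) (fun x : T =>
   2 * row_dev (rnode x) ^+ 2 + 2 * p%:R ^+ 2))).
  apply: ler_ex => // x; rewrite /row_dev.
  have -> : \sum_k rnode x k ^+ 2 = dot (rnode x) (rnode x).
    by apply: eq_bigr => k _; rewrite expr2.
  by have := sqr_ge0 (dot (rnode x) (rnode x) - 2 * p%:R); rewrite !expr2; nra.
by rewrite exD exZ ex_cst//; have := ex_row_dev2; lra.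
Qed.

End RowStatistics.

(** * Conditional risk of the quadratic form *)

Section Risk.
Context {R : realType}.
Variables (n p : nat) (beta : 'cV[R]_p).
Implicit Types (X : 'I_n -> 'I_p -> R) (v z : 'I_n -> R).
Notation tau2 := (sqnorm beta).

(** Cauchy-Schwarz through Lagrange's identity. *)
Lemma sqr_sum_mul_le (x y : 'I_n -> R) :
  (\sum_i x i * y i) ^+ 2 <= (\sum_i x i ^+ 2) * (\sum_i y i ^+ 2).
Proof.
have h : 0 <= \sum_i \sum_j (x i * y j - x j * y i) ^+ 2.
  by apply: sumr_ge0 => i _; apply: sumr_ge0 => j _; exact: sqr_ge0.
have E : \sum_i \sum_j (x i * y j - x j * y i) ^+ 2 =
    2 * ((\sum_i x i ^+ 2) * (\sum_i y i ^+ 2) - (\sum_i x i * y i) ^+ 2).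
  transitivity (\sum_i (x i ^+ 2 * (\sum_j y j ^+ 2) + (\sum_j x j ^+ 2) * y i ^+ 2
     - 2 * (x i * y i) * \sum_j x j * y j)).
    apply: eq_bigr => i _; rewrite mulr_suml !mulr_sumr -big_split -sumrB.
    by apply: eq_bigr => j _ /=; ring.
  rewrite sumrB big_split /= -!mulr_suml -!mulr_sumr; ring.
by move: h; rewrite E pmulr_rge0// subr_ge0.
Qed.

Definition dscale : R := (n * (n + 1))%:R^-1.
Definition dcoef : R := (p + n + 1)%:R * dscale.
Definition dmat X (i j : 'I_n) : R := dcoef * (i == j)%:R - dscale * dot (X i) (X j).

Lemma sum_delta_l (F : 'I_n -> R) i : \sum_j (i == j)%:R * F j = F i.
Proof.
rewrite (bigD1 i)//= eqxx mul1r big1 ?addr0// => j ji.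
by rewrite eq_sym (negPf ji) mul0r.
Qed.

Lemma dotC (x y : 'I_p -> R) : dot x y = dot y x.
Proof. by apply: eq_bigr => k _; rewrite mulrC. Qed.

Lemma dmatC X i j : dmat X i j = dmat X j i.
Proof. by rewrite /dmat eq_sym dotC. Qed.

Lemma dmat_row_mul X z i :
  \sum_j dmat X i j * z j = dcoef * z i - dscale * \sum_j dot (X i) (X j) * z j.
Proof.
rewrite -[z i in RHS](sum_delta_l z i) !mulr_sumr -sumrB.
by apply: eq_bigr => j _; rewrite /dmat; ring.
Qed.

Lemma sigma2_dickerE (X : 'M[R]_(n, p)) (Y : 'cV[R]_n) :
  sigma2_dicker X Y = \sum_i \sum_j dmat X i j * (Y i 0 * Y j 0).
Proof.
rewrite /sigma2_dicker -/dscale -/dcoef.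
have -> : sqnorm (X^T *m Y) = \sum_i Y i 0 * \sum_j dot (X i) (X j) * Y j 0.
  rewrite /sqnorm.
  transitivity (\sum_k \sum_i \sum_j Y i 0 * (X i k * X j k * Y j 0)).
    apply: eq_bigr => k _; rewrite !mxE expr2 mulr_suml; apply: eq_bigr => i _.
    rewrite mulr_sumr; apply: eq_bigr => j _; rewrite !mxE; ring.
  rewrite exchange_big; apply: eq_bigr => i _ /=.
  rewrite exchange_big mulr_sumr; apply: eq_bigr => j _ /=.
  by rewrite /dot mulr_suml mulr_sumr.
rewrite /sqnorm !mulr_sumr -sumrB; apply: eq_bigr => i _.
transitivity (Y i 0 * \sum_j dmat X i j * Y j 0).
  by rewrite dmat_row_mul; ring.
by rewrite mulr_sumr; apply: eq_bigr => j _; ring.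
Qed.

Lemma dot_diagE X i : dot (X i) (X i) = p%:R + row_dev (X i).
Proof.
rewrite /row_dev addrC subrK.
by apply: eq_bigr => k _; rewrite expr2.
Qed.

Lemma dot_offdiagE X i j :
  dot (X i) (X j) * row_lin beta (X j) = dot (X i) (row_err beta (X j)) + row_lin beta (X i).
Proof. by rewrite dot_row_err /row_lin; ring. Qed.

Lemma sum_neq_const (c : R) (i : 'I_n) : \sum_(j | j != i) c = (n%:R - 1) * c.
Proof.
have := sum_ord_const n c; rewrite (bigD1 i)//= => h.
by rewrite mulrBl mul1r -h addrAC subrr add0r.
Qed.

(** Here the coefficient [p + n + 1] pays off: of the multiples of [row_lin beta (X i)], the
    diagonal takes [p] and the off-diagonal terms [n - 1], so that only 2 remain. *)
Lemma dmat_lin X i : \sum_j dmat X i j * row_lin beta (X j) =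
  dscale * ((2 - row_dev (X i)) * row_lin beta (X i)
            - \sum_(j | j != i) dot (X i) (row_err beta (X j))).
Proof.
rewrite dmat_row_mul (bigD1 i)//= dot_diagE.
under eq_bigr do rewrite dot_offdiagE.
by rewrite big_split /= sum_neq_const /dcoef !natrD; ring.
Qed.

(** Its square has degree 8 in one entry, so it is not among the six statistics; Cauchy-Schwarz
    bounds it by [stat_lin4] and [stat_dev]. *)
Definition stat_mix X := \sum_i row_lin beta (X i) ^+ 2 * row_dev (X i).

Lemma sum_row_lin2 X :
  \sum_i row_lin beta (X i) ^+ 2 = stat_lin2 beta X + n%:R * tau2.
Proof. by rewrite /stat_lin2 sumrB sum_ord_const subrK. Qed.

(** A Hoeffding decomposition: since [row_lin] times the row is [row_err] plus [beta], the
    off-diagonal sum splits into [n - 1] copies of the linear part [stat_lin2] and the degenerate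
    part [stat_err]. *)
Lemma dmat_quad X :
  \sum_i row_lin beta (X i) * \sum_j dmat X i j * row_lin beta (X j) =
  dscale * ((3 - n%:R) * stat_lin2 beta X + 2 * n%:R * tau2 - stat_mix X - stat_err beta X).
Proof.
pose v i := row_lin beta (X i).
have E i j : v i * dot (X i) (row_err beta (X j)) =
    v j ^+ 2 - tau2 + dot (row_err beta (X i)) (row_err beta (X j)).
  rewrite row_lin2E /dot mulr_sumr -big_split; apply: eq_bigr => k _.
  by rewrite /row_err -/(v i) /=; ring.
have sv : \sum_i v i ^+ 2 = stat_lin2 beta X + n%:R * tau2 by exact: sum_row_lin2.
transitivity (\sum_i dscale * ((2 * v i ^+ 2 - v i ^+ 2 * row_dev (X i))
   - ((\sum_j v j ^+ 2 - n%:R * tau2) - (v i ^+ 2 - tau2))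
   - \sum_(j | j != i) dot (row_err beta (X i)) (row_err beta (X j)))).
  apply: eq_bigr => i _; rewrite dmat_lin -/(v i).
  have -> : \sum_j v j ^+ 2 - n%:R * tau2 = \sum_j (v j ^+ 2 - tau2).
    by rewrite sumrB sum_ord_const.
  have -> : \sum_j (v j ^+ 2 - tau2) - (v i ^+ 2 - tau2) =
      \sum_(j < n | j != i) (v j ^+ 2 - tau2).
    by rewrite (bigD1 i)//= addrAC subrr add0r.
  have -> : \sum_(j < n | j != i) (v j ^+ 2 - tau2) =
     v i * (\sum_(j | j != i) dot (X i) (row_err beta (X j))) -
     \sum_(j | j != i) dot (row_err beta (X i)) (row_err beta (X j)).
    rewrite mulr_sumr -sumrB; apply: eq_bigr => j _.
    by rewrite E addrK.
  ring.
rewrite -mulr_sumr; congr (_ * _).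
rewrite !sumrB -mulr_sumr !sum_ord_const sv.
rewrite /stat_err /stat_mix; ring.
Qed.

(** Since [n * (dcoef - dscale * p)] is exactly 1, the trace differs from 1 only by the fluctuation
    of the row norms. *)
Lemma dmat_trace X : (0 < n)%N ->
  \sum_i dmat X i i - 1 = - (dscale * \sum_i row_dev (X i)).
Proof.
move=> n0; have nz : (n * (n + 1))%:R != 0 :> R.
  by rewrite pnatr_eq0 -lt0n muln_gt0 n0 addn1.
under eq_bigr => i _ do rewrite /dmat eqxx mulr1 dot_diagE mulrDr opprD addrA.
rewrite sumrB sum_ord_const -mulr_sumr.
have -> : n%:R * (dcoef - dscale * p%:R) = (n * (n + 1))%:R * dscale.
  by rewrite /dcoef natrM !natrD; ring.
by rewrite /dscale divff//; ring.
Qed.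

Lemma dmat_sqr_le X : \sum_i \sum_j dmat X i j ^+ 2 <=
  2 * (n%:R * dcoef ^+ 2) + 2 * (dscale ^+ 2 * stat_gram X).
Proof.
rewrite -(sum_ord_const n) /stat_gram !mulr_sumr -big_split; apply: ler_sum => i _ /=.
rewrite -(sum_delta_l (fun=> dcoef ^+ 2) i) !mulr_sumr -big_split; apply: ler_sum => j _ /=.
rewrite /dmat; case: (i == j) => /=.
  rewrite mul1r mulr1 -exprMn.
  by have := sqr_ge0 (dcoef + dscale * dot (X i) (X j)); lra.
by rewrite !mulr0 mul0r mulr0 sub0r sqrrN exprMn; have := mulr_ge0 (sqr_ge0 dscale) (sqr_ge0 (dot (X i) (X j))); lra.
Qed.

(** The squared error has degree 4 in each response, so this finite sum is the Gaussian conditional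
    mean squared error itself. *)
Definition risk (X : 'M[R]_(n, p)) (sigma2 : R) : R :=
  ex (pw (@gweight R)) (fun w : {ffun 'I_n -> 'I_3} =>
    (sigma2_dicker X (ycol (X *m beta) (Num.sqrt sigma2) w) - sigma2) ^+ 2).

(** This is the conditional bias [mu^T M mu + sigma2 (tr M - 1)] after the cancellations of
    [dmat_quad] and [dmat_trace]. *)
Definition dbias X (sigma2 : R) : R :=
  dscale * ((3 - n%:R) * stat_lin2 beta X + 2 * n%:R * tau2 - stat_mix X
     - stat_err beta X - sigma2 * \sum_i row_dev (X i)).

(** With [Y = mu + s e] the error is the bias, plus [2 s] times the linear form of [M mu], plus
    [sigma2] times a centred quadratic form. Squaring three terms costs 3; then 24 is 3 times 4
    times 2 for the linear part and 3 times 8 for the quadratic part. *)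
Lemma risk_le (X : 'M[R]_(n, p)) sigma2 : (0 < n)%N -> 0 < sigma2 ->
  risk X sigma2 <= 3 * dbias X sigma2 ^+ 2
    + 24 * sigma2 * (\sum_i (\sum_j dmat X i j * row_lin beta (X j)) ^+ 2)
    + 24 * sigma2 ^+ 2 * \sum_i \sum_j dmat X i j ^+ 2.
Proof.
move=> n0 s0; set s := Num.sqrt sigma2.
have ss : s ^+ 2 = sigma2 by rewrite sqr_sqrtr// ltW.
have dg := @is_dist_gweight R; have dY := @is_dist_pw R 'I_n _ _ dg.
pose Mv i := \sum_j dmat X i j * row_lin beta (X j).
pose L (w : {ffun 'I_n -> 'I_3}) := \sum_i Mv i * gnode (w i).
pose Q (w : {ffun 'I_n -> 'I_3}) :=
  \sum_i \sum_j dmat X i j * (gnode (w i) * gnode (w j)) - \sum_i dmat X i i.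
have E w : sigma2_dicker X (ycol (X *m beta) s w) - sigma2 =
    dbias X sigma2 + 2 * s * L w + sigma2 * Q w.
  have -> : dbias X sigma2 = \sum_i row_lin beta (X i) * Mv i
      + sigma2 * (\sum_i dmat X i i - 1).
    by rewrite dmat_quad dmat_trace// /dbias; ring.
  have mu i : (X *m beta) i 0 = row_lin beta (X i) by rewrite mxE.
  have LE : \sum_i row_lin beta (X i) * (\sum_j dmat X i j * gnode (w j)) = L w.
    under eq_bigr do rewrite mulr_sumr.
    rewrite exchange_big; apply: eq_bigr => j _ /=.
    by rewrite /Mv mulr_suml; apply: eq_bigr => i _; rewrite dmatC; ring.
  rewrite sigma2_dickerE /Q mulrBr mulrBr mulr1.
  have -> : \sum_i \sum_j dmat X i j * (ycol (X *m beta) s w i 0 * ycol (X *m beta) s w j 0)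
    = \sum_i row_lin beta (X i) * Mv i + s * L w
      + s * (\sum_i row_lin beta (X i) * (\sum_j dmat X i j * gnode (w j)))
      + sigma2 * \sum_i \sum_j dmat X i j * (gnode (w i) * gnode (w j)).
    rewrite /L !mulr_sumr -!big_split; apply: eq_bigr => i _ /=.
    transitivity (\sum_j (row_lin beta (X i) * (dmat X i j * row_lin beta (X j))
       + s * (dmat X i j * row_lin beta (X j) * gnode (w i))
       + s * (row_lin beta (X i) * (dmat X i j * gnode (w j)))
       + sigma2 * (dmat X i j * (gnode (w i) * gnode (w j))))).
      by apply: eq_bigr => j _; rewrite !mxE -!mu -ss !mxE; ring.
    by rewrite !big_split /= /Mv !(mulr_sumr, mulr_suml).
  rewrite LE; ring.
apply: (@le_trans _ _ (ex (pw (@gweight R)) (fun w : {ffun 'I_n -> 'I_3} =>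
   3 * dbias X sigma2 ^+ 2 + 12 * sigma2 * L w ^+ 2 + 3 * sigma2 ^+ 2 * Q w ^+ 2))).
  apply: ler_ex => // w; rewrite -/s E.
  rewrite (_ : 12 * sigma2 * L w ^+ 2 = 3 * (2 * s * L w) ^+ 2); last by rewrite -ss; ring.
  rewrite -[3 * sigma2 ^+ 2 * _]mulrA -exprMn.
  move: (dbias _ _) (2 * s * L w) (sigma2 * Q w) => a b c.
  by have := sqr_ge0 (a - b); have := sqr_ge0 (b - c); have := sqr_ge0 (a - c); lra.
rewrite !exD ex_cst// !exZ.
have hL : ex (pw (@gweight R)) (fun w => L w ^+ 2) <= 2 * \sum_i Mv i ^+ 2.
  apply: le_trans (ex_pw_sqr_sum_le dg (f := fun i t => Mv i * gnode t) _) _.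
    by move=> i; rewrite exZ ex_gnode mulr0.
  rewrite ler_wpM2l//; apply: ler_sum => i _.
  by under eq_ex do rewrite exprMn; rewrite exZ ex_gnode2 mulr1.
have hQ := ex_quadratic_form (dmat X).
apply: lerD; first apply: lerD => //.
  rewrite [leRHS](_ : _ = 12 * sigma2 * (2 * \sum_i Mv i ^+ 2)); last by rewrite /Mv; ring.
  by rewrite ler_wpM2l// mulr_ge0// ltW.
rewrite [leRHS](_ : _ = 3 * sigma2 ^+ 2 * (8 * \sum_i \sum_j dmat X i j ^+ 2)); last by ring.
by rewrite ler_wpM2l// mulr_ge0// sqr_ge0.
Qed.

End Risk.

(** * Deterministic risk bound on the good designs *)

Section RiskBound.
Context {R : realType}.

(** The summands are the coefficients of [b ^+ 2 * T] in the bounds for squared bias (15 is 3 times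
    5, for five bias terms), linear noise (72 is 24 times 3) and quadratic noise. *)
Definition risk_const B0 kappa : R :=
  15 * (6 + 5 * B0 ^+ 2) + 72 * B0 * (6 + 5 * B0) + 24 * B0 ^+ 2 * (2 * (kappa + 2) ^+ 2 + 2).

Lemma risk_const_ge0 B0 kappa : 0 <= B0 -> 0 <= kappa -> 0 <= risk_const B0 kappa.
Proof.
move=> B0p k0; have sB := sqr_ge0 B0; have sk := sqr_ge0 (kappa + 2).
by rewrite /risk_const !addr_ge0// mulr_ge0// ?addr_ge0// mulr_ge0.
Qed.

Variables (n p : nat) (beta : 'cV[R]_p) (X : 'M[R]_(n, p)) (sigma2 B0 kappa L : R).
Notation tau2 := (sqnorm beta).
Hypotheses (n0 : (0 < n)%N) (s0 : 0 < sigma2) (sB : sigma2 <= B0) (tB : tau2 <= B0)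
  (k0 : 0 <= kappa) (pn : p%:R <= kappa * n%:R) (L1 : 1 <= L) (L4 : L ^+ 4 = n%:R)
  (hD : stat_dev X <= L ^+ 9) (hV : stat_lin4 beta X <= L ^+ 5)
  (he : stat_lin2 beta X ^+ 2 <= L ^+ 5) (hU : stat_err beta X ^+ 2 <= L ^+ 13)
  (hG : stat_gram X <= L ^+ 13) (hW : stat_cross beta X <= L ^+ 13).

Let b : R := dscale n.
(** The exponent is 9 + 5, from the product of the bounds on [stat_dev] and [stat_lin4]. As
    [b <= L ^- 8], the quantity [b ^+ 2 * T] is at most [L ^- 2]. *)
Let T := L ^+ 14.

Let L0 : 0 < L. Proof. by apply: lt_le_trans L1. Qed.
Let t0 : 0 <= tau2. Proof. exact: sqnorm_ge0. Qed.
Let B0p : 0 <= B0. Proof. by apply: le_trans (ltW s0) sB. Qed.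
Let powL i j : (i <= j)%N -> L ^+ i <= L ^+ j.
Proof. by move=> ij; apply: ler_weXn2l. Qed.
Let powL0 i : 0 <= L ^+ i. Proof. by rewrite exprn_ge0// ltW. Qed.
Let T0 : 0 <= T. Proof. exact: powL0. Qed.

Let bias_le : dbias beta X sigma2 ^+ 2 <= b ^+ 2 * (5 * ((6 + 5 * B0 ^+ 2) * T)).
Proof.
rewrite /dbias exprMn ler_wpM2l ?sqr_ge0//.
have D0 : 0 <= stat_dev X by apply: sumr_ge0 => i _; exact: sqr_ge0.
have h1 : ((3 - n%:R) * stat_lin2 beta X) ^+ 2 <= 4 * T.
  rewrite exprMn.
  apply: (@le_trans _ _ (4 * n%:R ^+ 2 * L ^+ 5)).
    apply: ler_pM => //; rewrite ?sqr_ge0//.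
    have : (1 : R) <= n%:R by rewrite ler1n.
    by move: (n%:R : R) => N N1; nra.
  rewrite -mulrA ler_wpM2l// -L4 -exprM -exprD; exact: powL.
have h2 : (2 * n%:R * tau2) ^+ 2 <= 4 * B0 ^+ 2 * T.
  rewrite !exprMn -L4 -exprM.
  have : tau2 ^+ 2 <= B0 ^+ 2 by rewrite ler_sqr.
  have : L ^+ (4 * 2) <= T by exact: powL.
  have := powL0 (4 * 2); have := sqr_ge0 tau2.
  move: (L ^+ (4 * 2)) (tau2 ^+ 2) (B0 ^+ 2) => x y z y0 x0 xT yz.
  have : x * y <= T * z by apply: ler_pM.
  by rewrite (_ : 2 ^+ 2 = 4 :> R)//; [nra|ring].
have h3 : stat_mix beta X ^+ 2 <= T.
  apply: le_trans (sqr_sum_mul_le _ _) _.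
  rewrite (_ : T = L ^+ 5 * L ^+ 9); last by rewrite -exprD.
  apply: ler_pM => //; first by apply: sumr_ge0 => i _; exact: sqr_ge0.
  apply: le_trans hV; apply: ler_sum => i _; by rewrite -exprM.
have h4 : stat_err beta X ^+ 2 <= T by apply: le_trans hU _; exact: powL.
have h5 : (sigma2 * \sum_i row_dev (X i)) ^+ 2 <= B0 ^+ 2 * T.
  rewrite exprMn; apply: ler_pM; rewrite ?sqr_ge0//.
    by rewrite ler_sqr// ?nnegrE// ltW.
  have := sqr_sum_mul_le (fun=> 1) (fun i => row_dev (X i)).
  under [X in X ^+ 2 <= _ -> _]eq_bigr do rewrite mul1r.
  move=> /le_trans; apply.
  under eq_bigr do rewrite expr1n.
  rewrite sum_ord_const mulr1 -L4.
  apply: (@le_trans _ _ (L ^+ 4 * L ^+ 9)); first by rewrite ler_wpM2l.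
  by rewrite -exprD; exact: powL.
move: h1 h2 h3 h4 h5.
move: (_ * stat_lin2 _ _) (2 * n%:R * tau2) (stat_mix _ _) (stat_err _ _) (sigma2 * _).
move=> x1 x2 x3 x4 x5 h1 h2 h3 h4 h5.
have c5 : (x1 + x2 - x3 - x4 - x5) ^+ 2 <=
    5 * (x1 ^+ 2 + x2 ^+ 2 + x3 ^+ 2 + x4 ^+ 2 + x5 ^+ 2).
  have := sqr_ge0 (x1 - x2); have := sqr_ge0 (x1 + x3); have := sqr_ge0 (x1 + x4).
  have := sqr_ge0 (x1 + x5); have := sqr_ge0 (x2 + x3); have := sqr_ge0 (x2 + x4).
  have := sqr_ge0 (x2 + x5); have := sqr_ge0 (x3 - x4); have := sqr_ge0 (x3 - x5).
  have := sqr_ge0 (x4 - x5); lra.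
by apply: le_trans c5 _; rewrite ler_wpM2l// mulrDl; lra.
Qed.

Let sum_lin2_le : \sum_i row_lin beta (X i) ^+ 2 <= (1 + B0) * L ^+ 5.
Proof.
rewrite sum_row_lin2 -L4.
(* From [2 x - 1 <= x^2 <= y] and [1 <= y] follows [x <= y]. *)
have : stat_lin2 beta X <= L ^+ 5.
  have := sqr_ge0 (stat_lin2 beta X - 1); have : 1 <= L ^+ 5 by rewrite exprn_ege1.
  by move: he; move: (stat_lin2 _ _) (L ^+ 5) => x y; lra.
have : L ^+ 4 * tau2 <= L ^+ 5 * B0 by apply: ler_pM => //; exact: powL.
by rewrite mulrDl mul1r [B0 * _]mulrC; lra.
Qed.

Let lin_le : \sum_i (\sum_j dmat X i j * row_lin beta (X j)) ^+ 2 <=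
  b ^+ 2 * (3 * ((6 + 5 * B0) * T)).
Proof.
pose v i := row_lin beta (X i); pose r i := row_dev (X i).
pose w i := \sum_(j | j != i) dot (X i) (row_err beta (X j)).
apply: (@le_trans _ _ (\sum_i b ^+ 2 *
    (3 * (4 * v i ^+ 2 + stat_dev X * v i ^+ 2 + w i ^+ 2)))).
  apply: ler_sum => i _; rewrite dmat_lin exprMn ler_wpM2l ?sqr_ge0//.
  rewrite -/(v i) -/(w i).
  (* A single deviation is crudely bounded by the total; with the sum of squared linear forms of
     order [L ^+ 5] this still fits into [T]. *)
  have rD : r i ^+ 2 <= stat_dev X.
    rewrite /stat_dev (bigD1 i)//= lerDl; apply: sumr_ge0 => j _; exact: sqr_ge0.
  apply: (@le_trans _ _ (3 * (4 * v i ^+ 2 + r i ^+ 2 * v i ^+ 2 + w i ^+ 2))).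
    rewrite -/(r i) -exprMn mulrBl; move: (v i) (r i * v i) (w i) => x y z.
    have := sqr_ge0 (2 * x + y); have := sqr_ge0 (2 * x + z); have := sqr_ge0 (y - z).
    by rewrite !expr2; lra.
  by rewrite ler_wpM2l// lerD2r lerD2l ler_wpM2r// sqr_ge0.
rewrite -mulr_sumr ler_wpM2l ?sqr_ge0// -mulr_sumr ler_wpM2l// !big_split /= -!mulr_sumr.
have hv := sum_lin2_le; rewrite -/(v _) in hv.
have S0 : 0 <= \sum_i v i ^+ 2 by apply: sumr_ge0 => i _; exact: sqr_ge0.
have D0 : 0 <= stat_dev X by apply: sumr_ge0 => i _; exact: sqr_ge0.
have a1 : \sum_i v i ^+ 2 <= (1 + B0) * T.
  by apply: le_trans hv _; rewrite ler_wpM2l ?addr_ge0//; exact: powL.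
have a2 : stat_dev X * \sum_i v i ^+ 2 <= (1 + B0) * T.
  have -> : (1 + B0) * T = L ^+ 9 * ((1 + B0) * L ^+ 5).
    by rewrite /T (exprD L 9 5); ring.
  by apply: ler_pM.
have a3 : \sum_i w i ^+ 2 <= T by apply: le_trans hW _; exact: powL.
by move: a1 a2 a3; lra.
Qed.

Let dmat_le : \sum_i \sum_j dmat X i j ^+ 2 <=
  b ^+ 2 * ((2 * (kappa + 2) ^+ 2 + 2) * T).
Proof.
apply: le_trans (dmat_sqr_le X) _.
have gT : stat_gram X <= T by apply: le_trans hG _; exact: powL.
have aT : n%:R * dcoef n p ^+ 2 <= b ^+ 2 * ((kappa + 2) ^+ 2 * T) :> R.
  rewrite /dcoef exprMn -/b [_ ^+ 2 * b ^+ 2]mulrC mulrCA ler_wpM2l ?sqr_ge0//.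
  have h : (p + n + 1)%:R <= (kappa + 2) * n%:R.
    rewrite !natrD; have : (1 : R) <= n%:R by rewrite ler1n.
    by move: pn; lra.
  have h2 : (p + n + 1)%:R ^+ 2 <= ((kappa + 2) * n%:R) ^+ 2.
    by rewrite ler_sqr// nnegrE// mulr_ge0// addr_ge0.
  apply: (@le_trans _ _ (n%:R * ((kappa + 2) * n%:R) ^+ 2)); first by rewrite ler_wpM2l.
  rewrite exprMn mulrCA ler_wpM2l ?sqr_ge0// -L4 -exprM -exprD; exact: powL.
have : b ^+ 2 * stat_gram X <= b ^+ 2 * T by rewrite ler_wpM2l ?sqr_ge0.
by rewrite -/b; move: aT; lra.
Qed.

Lemma risk_small : risk beta X sigma2 <= risk_const B0 kappa / L ^+ 2.
Proof.
apply: le_trans (risk_le _ _ n0 s0) _.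
have bT : b ^+ 2 * T <= L ^- 2.
  have n1 : (0 : R) < n%:R by rewrite ltr0n.
  have : b <= L ^- 8.
    rewrite /b /dscale lef_pV2 ?posrE ?exprn_gt0// ?ltr0n ?muln_gt0 ?n0 ?addn1//.
    by rewrite (exprM L 4 2) L4 natrM expr2 ler_pM2l// ler_nat.
  have b0 : 0 <= b by rewrite invr_ge0.
  have L8 : 0 <= L ^- 8 by rewrite invr_ge0.
  move=> bL; apply: (@le_trans _ _ (L ^- 8 ^+ 2 * T)).
    by rewrite ler_wpM2r// ler_sqr.
  rewrite /T -exprVn -exprM -[(8 * 2)%N]/(2 + 14)%N exprD -mulrA -exprMn.
  by rewrite mulVf ?gt_eqF// expr1n mulr1 exprVn.
have hs : sigma2 ^+ 2 <= B0 ^+ 2 by rewrite ler_sqr// ?nnegrE// ltW.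
have kk : 0 <= 2 * (kappa + 2) ^+ 2 + 2 by rewrite addr_ge0// mulr_ge0// sqr_ge0.
have e1 : 3 * dbias beta X sigma2 ^+ 2 <= 15 * (6 + 5 * B0 ^+ 2) * (b ^+ 2 * T).
  by have := bias_le; nra.
have e2 : 24 * sigma2 * (\sum_i (\sum_j dmat X i j * row_lin beta (X j)) ^+ 2)
   <= 72 * B0 * (6 + 5 * B0) * (b ^+ 2 * T).
  rewrite (_ : 72 * B0 * (6 + 5 * B0) * (b ^+ 2 * T) =
     (24 * B0) * (b ^+ 2 * (3 * ((6 + 5 * B0) * T)))); last by ring.
  apply: ler_pM => //; first by rewrite mulr_ge0// ltW.
    by apply: sumr_ge0 => i _; exact: sqr_ge0.
  by rewrite ler_wpM2l.
have e3 : 24 * sigma2 ^+ 2 * \sum_i \sum_j dmat X i j ^+ 2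
   <= 24 * B0 ^+ 2 * (2 * (kappa + 2) ^+ 2 + 2) * (b ^+ 2 * T).
  rewrite (_ : 24 * B0 ^+ 2 * (2 * (kappa + 2) ^+ 2 + 2) * (b ^+ 2 * T) =
     (24 * B0 ^+ 2) * (b ^+ 2 * ((2 * (kappa + 2) ^+ 2 + 2) * T))); last by ring.
  apply: ler_pM => //; first by rewrite mulr_ge0// sqr_ge0.
    by apply: sumr_ge0 => i _; apply: sumr_ge0 => j _; exact: sqr_ge0.
  by rewrite ler_wpM2l.
apply: (@le_trans _ _ (risk_const B0 kappa * (b ^+ 2 * T))).
  rewrite /risk_const [leRHS]mulrDl [X in _ <= X + _]mulrDl.
  exact: lerD (lerD e1 e2) e3.
by rewrite ler_wpM2l// risk_const_ge0.
Qed.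

End RiskBound.

(** * Degrees of the statistics in a single entry *)

Section Degrees.
Context {R : realType}.
Variables (n p : nat) (beta : 'cV[R]_p) (X : 'M[R]_(n, p)) (i0 : 'I_n) (k0 : 'I_p).

Notation Xt t := (X + t *: delta_mx i0 k0).
Notation d a := (nat_of_bool (a == i0)).

(** The exponent is 1 in the row of the varied entry and 0 elsewhere. Of two distinct rows at least
    one is constant in [t], which keeps the off-diagonal sums within degree 4. *)
Lemma deg_le_entry a k : deg_le (d a) (fun t => Xt t a k).
Proof.
have E t : Xt t a k = X a k + t * ((a == i0) && (k == k0))%:R by rewrite !mxE.
case: (a == i0) E => /= E; last first.
  by apply: deg_le_ext (deg_le_cst 0 (X a k)) => t; rewrite E mulr0 addr0.
by apply: deg_le_ext (deg_le_affine (X a k) (k == k0)%:R) => t; rewrite E.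
Qed.

Lemma deg_le_row_lin a : deg_le (d a) (fun t => row_lin beta (Xt t a)).
Proof.
apply: deg_le_sum => k _.
by rewrite -[d a]addn0; apply: deg_leM (deg_le_entry _ _) (deg_le_cst _ _).
Qed.

Lemma deg_le_row_dev a : deg_le (2 * d a) (fun t => row_dev (Xt t a)).
Proof.
apply: deg_leB (deg_le_cst _ _); apply: deg_le_sum => k _.
exact: deg_leX (deg_le_entry _ _).
Qed.

Lemma deg_le_row_err a k : deg_le (2 * d a) (fun t => row_err beta (Xt t a) k).
Proof.
apply: deg_leB (deg_le_cst _ _); rewrite mul2n -addnn.
exact: deg_leM (deg_le_row_lin _) (deg_le_entry _ _).
Qed.

Lemma deg_le_dot e1 e2 (F G : R -> 'I_p -> R) :
  (forall k, deg_le e1 (F ^~ k)) -> (forall k, deg_le e2 (G ^~ k)) ->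
  deg_le (e1 + e2) (fun t => dot (F t) (G t)).
Proof. by move=> hF hG; apply: deg_le_sum => k _; exact: deg_leM. Qed.

Lemma deg_le_stat_dev : deg_le 4 (fun t => stat_dev (Xt t)).
Proof.
apply: deg_le_sum => a _; apply: deg_leW (deg_leX 2 (deg_le_row_dev a)).
by case: (_ == _).
Qed.

Lemma deg_le_stat_lin4 : deg_le 4 (fun t => stat_lin4 beta (Xt t)).
Proof.
apply: deg_le_sum => a _; apply: deg_leW (deg_leX 4 (deg_le_row_lin a)).
by case: (_ == _).
Qed.

Lemma deg_le_stat_lin2 : deg_le 4 (fun t => stat_lin2 beta (Xt t) ^+ 2).
Proof.
apply: (@deg_leX _ 2 2); apply: deg_le_sum => a _; apply: deg_leB (deg_le_cst _ _).
by apply: deg_leW (deg_leX 2 (deg_le_row_lin a)); case: (_ == _).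
Qed.

Lemma deg_le_stat_err : deg_le 4 (fun t => stat_err beta (Xt t) ^+ 2).
Proof.
apply: (@deg_leX _ 2 2); apply: deg_le_sum => a _; apply: deg_le_sum => j ja.
apply: deg_leW (deg_le_dot (deg_le_row_err a) (deg_le_row_err j)).
by move: ja; case: (eqVneq a i0) => [->|]; case: (eqVneq j i0).
Qed.

Lemma deg_le_stat_gram : deg_le 4 (fun t => stat_gram (Xt t)).
Proof.
apply: deg_le_sum => a _; apply: deg_le_sum => j _.
apply: deg_leW (deg_leX 2 (deg_le_dot (deg_le_entry a) (deg_le_entry j))).
by case: (_ == _); case: (_ == _).
Qed.

Lemma deg_le_stat_cross : deg_le 4 (fun t => stat_cross beta (Xt t)).
Proof.
apply: deg_le_sum => a _; apply: (@deg_leX _ 2 2); apply: deg_le_sum => j ja.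
apply: deg_leW (deg_le_dot (deg_le_entry a) (deg_le_row_err j)).
by move: ja; case: (eqVneq a i0) => [->|]; case: (eqVneq j i0).
Qed.

End Degrees.

Lemma deg_le_sigma2_dicker (R : realType) n p (X : 'M[R]_(n, p)) (Y : 'cV[R]_n) i :
  deg_le 2 (fun t => sigma2_dicker X (Y + t *: delta_mx i 0)).
Proof.
have dY a : deg_le 1 (fun t => (Y + t *: delta_mx i 0) a 0).
  by apply: deg_le_ext (deg_le_affine (Y a 0) ((a == i) && true)%:R) => t; rewrite !mxE.
suff: deg_le 2 (fun t => \sum_a \sum_j dmat X a j *
    ((Y + t *: delta_mx i 0) a 0 * (Y + t *: delta_mx i 0) j 0)).
  by apply: deg_le_ext => t; rewrite sigma2_dickerE.
apply: deg_le_sum => a _; apply: deg_le_sum => j _; apply: deg_leZ.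
exact: deg_leM (dY a) (dY j).
Qed.

(** * Probability of the good designs and Chebyshev's inequality *)

Section Assembly.
Context {R : realType}.
Variables (n p : nat) (beta : 'cV[R]_p) (sigma2 B0 kappa L : R).
Notation tau2 := (sqnorm beta).
Hypotheses (n0 : (0 < n)%N) (s0 : 0 < sigma2) (sB : sigma2 <= B0) (tB : tau2 <= B0)
  (k0 : 0 <= kappa) (pn : p%:R <= kappa * n%:R) (L1 : 1 <= L) (L4 : L ^+ 4 = n%:R).

Let L0 : 0 < L. Proof. by apply: lt_le_trans L1. Qed.
Let t0 : 0 <= tau2. Proof. exact: sqnorm_ge0. Qed.
Let B0p : 0 <= B0. Proof. by apply: le_trans (ltW s0) sB. Qed.
Let powL0 i : 0 < L ^+ i. Proof. by rewrite exprn_gt0. Qed.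

(* Each statistic is normalised by L times its typical size, where L = n^(1/4). *)
Definition stat_total (X : 'I_n -> 'I_p -> R) : R :=
  L ^- 9 * stat_dev X + L ^- 5 * stat_lin4 beta X + L ^- 5 * stat_lin2 beta X ^+ 2
  + L ^- 13 * stat_err beta X ^+ 2 + L ^- 13 * stat_gram X + L ^- 13 * stat_cross beta X.

Definition total_const : R :=
  8 * kappa + 18 * B0 ^+ 2 + 16 * B0 ^+ 2 + 128 * (kappa * B0 ^+ 2)
  + (18 * kappa + 2 * kappa ^+ 2) + 16 * (kappa * B0).

Lemma deg_le_stat_total (X : 'M[R]_(n, p)) i k :
  deg_le 4 (fun t => stat_total (X + t *: delta_mx i k)).
Proof.
rewrite /stat_total; repeat (apply: deg_leD); apply: deg_leZ.
- exact: deg_le_stat_dev.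
- exact: deg_le_stat_lin4.
- exact: deg_le_stat_lin2.
- exact: deg_le_stat_err.
- exact: deg_le_stat_gram.
- exact: deg_le_stat_cross.
Qed.

Let term_ge0 (X : 'I_n -> 'I_p -> R) :
  [/\ 0 <= L ^- 9 * stat_dev X, 0 <= L ^- 5 * stat_lin4 beta X,
      0 <= L ^- 5 * stat_lin2 beta X ^+ 2, 0 <= L ^- 13 * stat_err beta X ^+ 2
    & 0 <= L ^- 13 * stat_gram X /\ 0 <= L ^- 13 * stat_cross beta X].
Proof.
have V i : 0 <= L ^- i by rewrite invr_ge0 ltW.
split; [| | | |split]; apply: mulr_ge0 => //; rewrite ?sqr_ge0//.
- by apply: sumr_ge0 => i _; exact: sqr_ge0.
- by apply: sumr_ge0 => i _; rewrite exprn_even_ge0.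
- by apply: sumr_ge0 => i _; apply: sumr_ge0 => j _; exact: sqr_ge0.
- by apply: sumr_ge0 => i _; exact: sqr_ge0.
Qed.

Lemma stat_total_ge0 X : 0 <= stat_total X.
Proof. by rewrite /stat_total; have [? ? ? ? [? ?]] := term_ge0 X; rewrite !addr_ge0. Qed.

Lemma risk_of_stat_total (X : 'M[R]_(n, p)) : stat_total X < 1 ->
  risk beta X sigma2 <= risk_const B0 kappa / L ^+ 2.
Proof.
rewrite /stat_total => lt1; have [h1 h2 h3 h4 [h5 h6]] := term_ge0 X.
have K i (x : R) : L ^- i * x <= 1 -> x <= L ^+ i by rewrite mulrC ler_pdivrMr// mul1r.
by apply: risk_small => //; apply: K; lra.
Qed.

(** Each weight has one power of [L] more than the expected size of its statistic, so every term is
    of order [1 / L], with constants depending on [kappa] and [B0] alone. *)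
Lemma ex_stat_total :
  ex (pw (pw (@gweight R))) (fun w : {ffun 'I_n -> {ffun 'I_p -> 'I_3}} =>
    stat_total (fun i => rnode (w i))) <= total_const / L.
Proof.
rewrite /stat_total !exD !exZ.
have N0 : (0 : R) <= n%:R by [].
have K i (x c : R) : x <= c * L ^+ i -> L ^- i.+1 * x <= c / L.
  move=> h; rewrite mulrC ler_pdivrMr//; apply: le_trans h _.
  by rewrite exprS mulrA divfK// gt_eqF.
have tB2 : tau2 ^+ 2 <= B0 ^+ 2 by rewrite ler_sqr.
have p0 : (0 : R) <= p%:R by [].
have L8 : L ^+ 8 = n%:R ^+ 2 by rewrite -L4 -exprM.
have L12 : L ^+ 12 = n%:R ^+ 3 by rewrite -L4 -exprM.
have b1 : ex (pw (pw (@gweight R))) (fun w : {ffun 'I_n -> {ffun 'I_p -> 'I_3}} =>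
    stat_dev (fun i => rnode (w i))) <= (8 * kappa) * L ^+ 8.
  apply: le_trans (ex_stat_dev _ _) _; rewrite L8 -mulrA ler_wpM2l//.
  by rewrite mulrC expr2 mulrA ler_wpM2r.
have b2 : ex (pw (pw (@gweight R))) (fun w : {ffun 'I_n -> {ffun 'I_p -> 'I_3}} =>
    stat_lin4 beta (fun i => rnode (w i))) <= (18 * B0 ^+ 2) * L ^+ 4.
  apply: le_trans (ex_stat_lin4 _ _) _; rewrite L4 -mulrA ler_wpM2l//.
  by rewrite mulrC ler_wpM2r.
have b3 : ex (pw (pw (@gweight R))) (fun w : {ffun 'I_n -> {ffun 'I_p -> 'I_3}} =>
    stat_lin2 beta (fun i => rnode (w i)) ^+ 2) <= (16 * B0 ^+ 2) * L ^+ 4.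
  apply: le_trans (ex_stat_lin2 _ _) _; rewrite L4 -mulrA ler_wpM2l//.
  by rewrite mulrC ler_wpM2r.
have b4 : ex (pw (pw (@gweight R))) (fun w : {ffun 'I_n -> {ffun 'I_p -> 'I_3}} =>
    stat_err beta (fun i => rnode (w i)) ^+ 2) <= (128 * (kappa * B0 ^+ 2)) * L ^+ 12.
  apply: le_trans (ex_stat_err _ _) _; rewrite L12 -mulrA ler_wpM2l//.
  rewrite (_ : kappa * _ * _ = n%:R ^+ 2 * (B0 ^+ 2 * (kappa * n%:R))); last by ring.
  by rewrite ler_wpM2l ?sqr_ge0//; apply: ler_pM => //; exact: sqr_ge0.
have b5 : ex (pw (pw (@gweight R))) (fun w : {ffun 'I_n -> {ffun 'I_p -> 'I_3}} =>
    stat_gram (fun i => rnode (w i))) <= (18 * kappa + 2 * kappa ^+ 2) * L ^+ 12.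
  apply: le_trans (ex_stat_gram _ _) _; rewrite L12.
  have c1 : n%:R ^+ 2 * (2 * p%:R) <= 2 * kappa * n%:R ^+ 3 :> R.
    rewrite (_ : 2 * kappa * _ = n%:R ^+ 2 * (2 * (kappa * n%:R))); last by ring.
    by rewrite ler_wpM2l ?sqr_ge0// ler_wpM2l.
  have c2 : n%:R * (16 * p%:R) <= 16 * kappa * n%:R ^+ 3 :> R.
    apply: (@le_trans _ _ (n%:R * (16 * (kappa * n%:R)))).
      by rewrite ler_wpM2l// ler_wpM2l.
    rewrite (_ : n%:R * _ = 16 * kappa * n%:R ^+ 2); last by ring.
    by rewrite ler_wpM2l ?mulr_ge0// ler_weXn2l// ler1n.
  have c3 : n%:R * (2 * p%:R ^+ 2) <= 2 * kappa ^+ 2 * n%:R ^+ 3 :> R.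
    rewrite (_ : 2 * kappa ^+ 2 * _ = n%:R * (2 * (kappa * n%:R) ^+ 2)); last by ring.
    by rewrite ler_wpM2l// ler_wpM2l// ler_sqr// nnegrE mulr_ge0.
  by rewrite mulrDr; lra.
have b6 : ex (pw (pw (@gweight R))) (fun w : {ffun 'I_n -> {ffun 'I_p -> 'I_3}} =>
    stat_cross beta (fun i => rnode (w i))) <= (16 * (kappa * B0)) * L ^+ 12.
  apply: le_trans (ex_stat_cross _ _) _; rewrite L12 -mulrA ler_wpM2l//.
  rewrite (_ : kappa * _ * _ = n%:R ^+ 2 * (B0 * (kappa * n%:R))); last by ring.
  by rewrite ler_wpM2l ?sqr_ge0//; apply: ler_pM.
have leDL (x y c d : R) : x <= c / L -> y <= d / L -> x + y <= (c + d) / L.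
  by move=> xc yd; rewrite [leRHS]mulrDl lerD.
by rewrite /total_const; do 5 (apply: (leDL); last exact: (K)); exact: (K).
Qed.

(** Markov's inequality through the minorant [1 - stat_total]: it is nonpositive once the total
    reaches 1, and below 1 each nonnegative term is below 1, as [risk_small] requires. *)
Lemma prX_risk_ge :
  ((1 - total_const / L)%:E <=
    prX [set X : 'M[R]_(n, p) | (risk beta X sigma2 <= risk_const B0 kappa / L ^+ 2)%R])%E.
Proof.
pose f (X : 'M[R]_(n, p)) := 1 - stat_total X.
have df X i j : deg_le 4 (fun t => f (X + t *: delta_mx i j)).
  by apply: deg_leB (deg_le_cst _ _) (deg_le_stat_total _ _ _).
have fA X : f X <= \1_[set X : 'M[R]_(n, p) |
    (risk beta X sigma2 <= risk_const B0 kappa / L ^+ 2)%R] X.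
  rewrite indicE /f; have := stat_total_ge0 X.
  have [lt1 ge0|ge1 _] := ltP (stat_total X) 1.
    by rewrite mem_set ?lerBlDr ?lerDl//=; exact: risk_of_stat_total.
  by apply: le_trans (ler0n _ _); rewrite subr_le0.
apply: le_trans (prX_ge df fA).
rewrite lee_fin /f exB ex_cst; last exact/is_dist_pw/is_dist_pw/is_dist_gweight.
  rewrite lerD2l lerN2; apply: le_trans ex_stat_total.
  rewrite le_eqVlt; apply/orP; left; apply/eqP; apply: eq_ex => w; congr stat_total.
  by apply/funext => i; apply/funext => k; rewrite mxE.
Qed.

End Assembly.

Lemma prY_risk_le (R : realType) n p (beta : 'cV[R]_p) (X : 'M[R]_(n, p)) (sigma2 xi : R) :
  0 < sigma2 -> 0 < xi ->
  (prY (X *m beta) sigma2 [set Y | (xi <= `|sigma2_dicker X Y - sigma2|)%R]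
    <= (risk beta X sigma2 / xi ^+ 2)%:E)%E.
Proof.
move=> s0 xi0.
pose f (Y : 'cV[R]_n) := (sigma2_dicker X Y - sigma2) ^+ 2 * xi ^- 2.
have df Y i : deg_le 4 (fun t => f (Y + t *: delta_mx i 0)).
  rewrite -[4%N]addn0; apply: deg_leM (deg_le_cst _ _).
  apply: (@deg_leX _ 2 2); apply: deg_leB (deg_le_cst _ _).
  exact: deg_le_sigma2_dicker.
have fE Y : \1_[set Y | (xi <= `|sigma2_dicker X Y - sigma2|)%R] Y <= f Y.
  rewrite indicE /f; have [|_] := boolP (Y \in _).
    rewrite inE /= => h; rewrite ler_pdivlMr ?exprn_gt0// mul1r.
    by rewrite -[leRHS]real_normK ?num_real// ler_sqr// nnegrE ltW.
  by rewrite mulr_ge0 ?sqr_ge0// invr_ge0 sqr_ge0.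
by apply: le_trans (prY_le _ s0 df fE) _; rewrite /f exZr.
Qed.

(** Turns the uniform bound [K / sqrt n] into the stated one. *)
Lemma gfun_ge1 (R : realType) (c : R) n (mu : 'cV[R]_n) sigma2 :
  1 <= c -> 0 < sigma2 -> 1 <= gfun c mu sigma2.
Proof.
move=> c1 s0; rewrite /gfun -!addrA lerDl.
have c0 : 0 <= c by apply: le_trans c1.
have s1 := ltW s0; have m0 := sqnorm_ge0 mu.
by rewrite !addr_ge0// ?mulr_ge0// ?addr_ge0// ?mulr_ge0// ?sqr_ge0 ?invr_ge0.
Qed.

(** * Choice of the sets and the limit *)

Unset Implicit Arguments.

Theorem theorem1 (R : realType) (p : nat -> nat) (c : R)
    (beta : forall n : nat, 'cV[R]_(p n)) (sigma2 : nat -> R) :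
  1 <= c ->
  ((fun n : nat => (p n)%:R / n%:R) @ \oo --> c) ->
  (forall n, 0 < sigma2 n) ->
  (exists B : R, forall n, sigma2 n <= B /\ sqnorm (beta n) <= B) ->
  exists (A : forall n : nat, set 'M[R]_(n, p n)) (C : R),
    ((fun n => prX (A n)) @ \oo --> 1%E) /\
    (forall (n : nat) (X : 'M[R]_(n, p n)), A n X ->
       forall xi : R, 0 < xi ->
       (prY (X *m beta n) (sigma2 n)
          [set Y | (xi <= `|sigma2_dicker X Y - sigma2 n|)%R]
        <= (C * gfun c (X *m beta n) (sigma2 n)
             / (xi ^+ 2 * Num.sqrt n%:R))%:E)%E).
Proof.
move=> c1 pc s0 [B hB].
pose B0 := Num.max B 0.
have sB n : sigma2 n <= B0 by rewrite le_max (proj1 (hB n)).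
have tB n : sqnorm (beta n) <= B0 by rewrite le_max (proj2 (hB n)).
have B0p : 0 <= B0 by rewrite le_max lexx orbT.
have [kappa k0 pk] : exists2 kappa : R, 0 <= kappa &
    forall n, (0 < n)%N -> (p n)%:R <= kappa * n%:R.
  have [M [_ hM]] : bounded_fun (fun n : nat => (p n)%:R / n%:R : R).
    by apply: cvg_seq_bounded; apply/cvg_ex; exists c.
  (* The sequence is bounded by every real above [M]; the absolute value makes the bound nonnegative
     as well. *)
  exists `|M + 1|; first exact: normr_ge0.
  move=> n n0; rewrite -ler_pdivrMr ?ltr0n//.
  have := hM `|M + 1| _ n I; rewrite /=.
  move=> h; apply: le_trans (ler_norm _) (h _).
  by apply: lt_le_trans (ler_norm _); rewrite ltrDl.
pose L n : R := Num.sqrt (Num.sqrt n%:R).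
have L2 n : L n ^+ 2 = Num.sqrt n%:R by rewrite sqr_sqrtr// sqrtr_ge0.
have L4 n : L n ^+ 4 = n%:R by rewrite (exprM _ 2 2) L2 sqr_sqrtr.
have L1 n : (0 < n)%N -> 1 <= L n.
  move=> n0; rewrite -[leLHS]sqrtr1 ler_psqrt ?nnegrE// ?sqrtr_ge0//.
  by rewrite -[leLHS]sqrtr1 ler_psqrt ?nnegrE// ler1n.
pose K := risk_const B0 kappa.
have K0 : 0 <= K by exact: risk_const_ge0.
(* The condition [0 < n] empties [A 0], where division by 0 would make the claimed bound equal to
   0. *)
pose A n := [set X : 'M[R]_(n, p n) | (0 < n)%N /\ risk (beta n) X (sigma2 n) <= K / L n ^+ 2].
exists A, K; split.
- have lb n : (0 < n)%N -> ((1 - total_const B0 kappa / L n)%:E <= prX (A n))%E.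
    move=> n0; apply: le_trans (prX_risk_ge n0 (s0 n) (sB n) (tB n) k0 (pk n n0) (L1 n n0) (L4 n)) _.
    rewrite le_eqVlt; apply/orP; left; apply/eqP; congr prX.
    by apply/seteqP; split=> X /=; [move=> h; split|case].
  have Linf : (fun n => (L n)^-1) @ \oo --> (0 : R).
    apply/gtr0_cvgV0.
      by near=> n; apply: lt_le_trans (L1 n _) => //; near: n; exact: nbhs_infty_gt.
    apply/cvgryPge => M; near=> n.
    apply: (@le_trans _ _ `|M|); first exact: ler_norm.
    (* [|M|] is rewritten as the double square root of [(M ^+ 2) ^+ 2], which [n] eventually
       exceeds. *)
    rewrite -[leLHS]sqrtr_sqr ler_psqrt ?nnegrE ?sqr_ge0 ?sqrtr_ge0//.
    rewrite -[leLHS]ger0_norm ?sqr_ge0// -sqrtr_sqr ler_psqrt ?nnegrE ?sqr_ge0//.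
    by near: n; exact: nbhs_infty_ger.
  apply: (@squeeze_cvge _ _ _ _ (fun n => (1 - total_const B0 kappa / L n)%:E) _ (fun=> 1%E)).
  + near=> n; rewrite lb ?gaussN_le1//.
    by near: n; exact: nbhs_infty_gt.
  + apply: cvg_EFin; first exact: nearW.
    rewrite -[X in _ --> X]subr0; apply: cvgB; first exact: cvg_cst.
    rewrite -(mulr0 (total_const B0 kappa)); apply: cvgM Linf; exact: cvg_cst.
  + exact: cvg_cst.
- move=> n X [n0 hX] xi xi0.
  apply: le_trans (prY_risk_le _ _ (s0 n) xi0) _.
  rewrite L2 in hX; rewrite lee_fin; set q := Num.sqrt _ in hX *.
  have g1 := gfun_ge1 (X *m beta n) c1 (s0 n).
  have V0 : 0 <= xi ^- 2 by rewrite invr_ge0 sqr_ge0.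
  have q0 : 0 <= q^-1 by rewrite invr_ge0 sqrtr_ge0.
  apply: (@le_trans _ _ (K / q * xi ^- 2)); first by rewrite ler_wpM2r.
  rewrite (_ : _ / (xi ^+ 2 * q) = K / q * xi ^- 2 * gfun c (X *m beta n) (sigma2 n)).
    by rewrite ler_peMr// !mulr_ge0.
  by rewrite invfM; ring.
Unshelve. all: by end_near.
Qed.
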